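(* Let $D\in\mathbb{T}[x_1,\dots,x_k]^{n\times n}$ be the weighted adjacency matrix of a directed graph on $n$ nodes, and suppose that $D$ has separated variables. Then, between any pair of nodes, there are at most $2^k$ pairwise incomparable shortest paths. Moreover, the Kleene star $D^*$, which encodes all parameterized shortest paths, can be computed in $O(k\cdot 2^k\cdot n^3)$ time, if it exists.
   Context: $\mathbb{T}=\mathbb{R}\cup\{\infty\}$ is the $(\min,+)$-semiring, with addition $\oplus=\min$ and multiplication $\odot=+$. A tropical polynomial $f\in\mathbb{T}[x_1,\dots,x_k]$ with finite support $S\subset\mathbb{Z}^k$ and coefficients $\gamma_a\in\mathbb{R}$ ($a\in S$) has evaluation function $f(t)=\min\{\gamma_a+a_1t_1+\dots+a_kt_k : a\in S\}$; the zero of the semiring is $\infty$. Tropical polynomials form a semiring, and so do $n\times n$ matrices over them (entrywise $\oplus$ and the usual matrix product with $\oplus,\odot$). Directed graphs have no parallel arcs. The weighted adjacency matrix $D=(d_{uv})$ has the weight of the arc $(u,v)$ as its entry $d_{uv}$, with $d_{uv}=\infty$ if there is no such arc. $D$ has separated variables if each indeterminate occurs, with multiplicity one, in the weight of at most one arc; each finite entry is then a real constant plus a sum of indeterminates, and, after replacing each such sum by a single variable, every entry is assumed to be $\infty$, a real constant $\lambda$, or $\lambda+x_i$. Partial ordering: $f\le g$ iff $f(z)\le g(z)$ for all $z\in\mathbb{T}^k$; $f,g$ are incomparable if neither $f\le g$ nor $g\le f$. The weight (length) of a path is the sum of the weights of its arcs; paths are compared via their weights; a path from $u$ to $v$ is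 shortest if no path from $u$ to $v$ has strictly smaller weight in this partial ordering (paths of weight $\infty$ are allowed). A negative cycle is a cycle whose total weight is comparable to and strictly less than $0$. The Kleene star is $D^*=I\oplus D\oplus D^{\odot 2}\oplus\cdots$, where $I$ has entries $0$ on the diagonal and $\infty$ elsewhere; when there is no negative cycle it is $(I\oplus D)^{\odot(n-1)}=I\oplus D\oplus\cdots\oplus D^{\odot(n-1)}$, and ''if it exists'' refers to this situation. Running time counts arithmetic operations and comparisons at unit cost.
   Formalization: Paths are simple. For D=(x_1) there is no negative cycle, yet the series for D* diverges at x_1<0; so the computed matrix must equal D* only at parameters where the series converges, being everywhere a sum of walk weights and at most every path weight. For k=0 the factor k is read as 1. *)

(* Defs.v *)
From HB Require Import structures.
From mathcomp Require Import all_boot all_order all_algebra.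
From mathcomp Require Import reals.

Set Implicit Arguments.
Unset Strict Implicit.
Unset Printing Implicit Defensive.

Import Order.TTheory GRing.Theory Num.Theory.
Local Open Scope ring_scope.

(* The (min,+)-semiring, [None] being oo.  As a MathComp semiring its [+] is  *)
(* min, its [*] is the addition of R, its [0] is oo and its [1] is the real 0.*)
Definition trop (R : realType) : Type := option R.

Section TropicalSemiring.
Variable R : realType.
Implicit Types a b c : trop R.

Definition tmin a b : trop R :=
  match a, b with
  | Some x, Some y => Some (Num.min x y)
  | Some x, None => Some x
  | None, _ => b
  end.

Definition tplus a b : trop R :=
  match a, b with
  | Some x, Some y => Some (x + y)
  | _, _ => None
  end.

Definition tle a b : bool :=
  match a, b with
  | _, None => true
  | None, Some _ => false
  | Some x, Some y => x <= y
  end.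

Fact tminA : associative tmin.
Proof. by move=> [x|] [y|] [z|] //=; rewrite minA. Qed.

Fact tminC : commutative tmin.
Proof. by move=> [x|] [y|] //=; rewrite minC. Qed.

Fact tmin0 : left_id None tmin.
Proof. by []. Qed.

Fact tplusA : associative tplus.
Proof. by move=> [x|] [y|] [z|] //=; rewrite addrA. Qed.

Fact tplusC : commutative tplus.
Proof. by move=> [x|] [y|] //=; rewrite addrC. Qed.

Fact tplus1 : left_id (Some 0) tplus.
Proof. by move=> [x|] //=; rewrite add0r. Qed.

Fact tplusDl : left_distributive tplus tmin.
Proof. by move=> [x|] [y|] [z|] //=; rewrite addr_minl. Qed.

Fact tplus0 : left_zero None tplus.
Proof. by []. Qed.

Fact trop_nontrivial : Some 0 != None :> trop R.
Proof. by []. Qed.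

HB.instance Definition _ := Choice.copy (trop R) (option R).
HB.instance Definition _ :=
  GRing.isNmodule.Build (trop R) tminA tminC tmin0.
HB.instance Definition _ := GRing.Nmodule_isComNzSemiRing.Build (trop R)
  tplusA tplusC tplus1 tplusDl tplus0 trop_nontrivial.

End TropicalSemiring.

(* T[x_1, .., x_k], built as T[x_1, .., x_(k-1)][x_k].  The exponents are     *)
(* natural numbers, so that the evaluation is defined on all of T^k.          *)
Fixpoint tpoly (R : realType) (k : nat) : comNzSemiRingType :=
  if k is k'.+1 then {poly tpoly R k'} else trop R.

Fixpoint tconst (R : realType) (k : nat) : trop R -> tpoly R k :=
  match k with
  | 0 => fun c => c
  | k'.+1 => fun c => (tconst k' c)%:P
  end.

Fixpoint tvar (R : realType) (k : nat) : 'I_k -> tpoly R k :=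
  match k with
  | 0 => fun=> 0
  | k'.+1 => fun i => if unlift ord_max i is Some j then (tvar R j)%:P else 'X
  end.

(* f |-> min {gamma_a + a_1 z_1 + .. + a_k z_k : a in the support of f}       *)
Fixpoint teval (R : realType) (k : nat) : tpoly R k -> ('I_k -> trop R) -> trop R :=
  match k with
  | 0 => fun f _ => f
  | k'.+1 => fun f z =>
      (map_poly (fun g => @teval R k' g (fun j => z (lift ord_max j))) f).[z ord_max]
  end.

Section Graphs.
Variables (R : realType) (k n : nat).
Implicit Types (f g : tpoly R k) (D P : 'M[tpoly R k]_n).

Definition tpoly_le f g : Prop :=
  forall z : 'I_k -> trop R, tle (teval f z) (teval g z).

Definition tpoly_lt f g : Prop := tpoly_le f g /\ ~ tpoly_le g f.

Definition incomparable f g : Prop := ~ tpoly_le f g /\ ~ tpoly_le g f.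

Definition occurs (i : 'I_k) f : Prop :=
  exists l : R, f = tconst k (Some l) * tvar R i.

Definition separated_variables D : Prop :=
  (forall u v : 'I_n,
     [\/ D u v = 0,
         exists l : R, D u v = tconst k (Some l)
       | exists i : 'I_k, occurs i (D u v)]) /\
  (forall (i : 'I_k) (u v u' v' : 'I_n),
     occurs i (D u v) -> occurs i (D u' v') -> u = u' /\ v = v').

(* The weight of the walk which visits the nodes u :: s in this order; it is  *)
(* [0], that is oo, if one of the arcs is missing.                            *)
Fixpoint weight D (u : 'I_n) (s : seq 'I_n) : tpoly R k :=
  if s is w :: s' then D u w * weight D w s' else 1.

Definition is_walk (u v : 'I_n) (s : seq 'I_n) : bool := last u s == v.

Definition is_path (u v : 'I_n) (s : seq 'I_n) : bool :=
  is_walk u v s && uniq (u :: s).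

Definition shortest_path D (u v : 'I_n) (s : seq 'I_n) : Prop :=
  is_path u v s /\
  forall s', is_path u v s' -> ~ tpoly_lt (weight D u s') (weight D u s).

(* The cycle through the distinct nodes u :: s is the walk back to u.         *)
Definition negative_cycle D : Prop :=
  exists u s, uniq (u :: s) /\ tpoly_lt (weight D u (rcons s u)) 1.

Definition kleene_star D : 'M[tpoly R k]_n := (1 + D) ^+ n.-1.

(* The parameters z at which the series I + D(z) + D(z)^2 + .. converges.     *)
(* An arc lambda + x_i on a cycle makes it diverge for z_i small, even when   *)
(* [~ negative_cycle D].                                                      *)
Definition feasible D (z : 'I_k -> trop R) : Prop :=
  forall u s, uniq (u :: s) -> tle 1 (teval (weight D u (rcons s u)) z).

(* P evaluates to D^* wherever the latter exists; on all of T^k each entry    *)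
(* of P is a sum of terms of the series I + D + D^2 + .. and bounds from      *)
(* below the weights of all paths.  The powers of x_i that (1 + D) ^+ n.-1    *)
(* gets from walks running through the arc of x_i repeatedly are not imposed  *)
(* on P: they are redundant on the feasible parameters.                       *)
Definition represents_kleene_star D P : Prop :=
  [/\ forall z, feasible D z ->
        forall u v, teval (P u v) z = teval (kleene_star D u v) z,
      forall u v, exists2 ws : seq (seq 'I_n),
        all (is_walk u v) ws & P u v = \sum_(s <- ws) weight D u s
    & forall u v s, is_path u v s -> tpoly_le (P u v) (weight D u s)].

End Graphs.

(* A random access machine, given as a structured language.  Its memory       *)
(* consists of multi-dimensional arrays, either of natural numbers or of      *)
(* elements of T; a cell is addressed by the name of its array and a list of  *)
(* indices, the empty list for a scalar.  Every constant, access, arithmetic  *)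
(* operation, comparison and assignment costs one unit.  On natural numbers   *)
(* there is only addition and truncated subtraction: unit-cost multiplication *)
(* would allow for exponentially long numbers.                                *)
Inductive nexp :=
  | NNum of nat
  | NGet of nat & seq nexp
  | NAdd of nexp & nexp
  | NSub of nexp & nexp.

Inductive texp :=
  | TInf
  | TZero
  | TGet of nat & seq nexp
  | TMin of texp & texp
  | TAdd of texp & texp.

Inductive bexp :=
  | NLe of nexp & nexp
  | TLe of texp & texp.

Inductive cmd :=
  | Skip
  | NSet of nat & seq nexp & nexp
  | TSet of nat & seq nexp & texp
  | Seq of cmd & cmd
  | If of bexp & cmd & cmd
  | While of bexp & cmd.

Fixpoint ncost (e : nexp) : nat :=
  match e with
  | NNum _ => 1
  | NGet _ es => (sumn (map ncost es)).+1
  | NAdd e1 e2 | NSub e1 e2 => (ncost e1 + ncost e2).+1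
  end.

Fixpoint tcost (e : texp) : nat :=
  match e with
  | TInf | TZero => 1
  | TGet _ es => (sumn (map ncost es)).+1
  | TMin e1 e2 | TAdd e1 e2 => (tcost e1 + tcost e2).+1
  end.

Definition bcost (b : bexp) : nat :=
  match b with
  | NLe e1 e2 => (ncost e1 + ncost e2).+1
  | TLe e1 e2 => (tcost e1 + tcost e2).+1
  end.

Section Machine.
Variable R : realType.

Record state := State {
  nmem : nat -> seq nat -> nat;
  tmem : nat -> seq nat -> trop R
}.

Fixpoint neval (st : state) (e : nexp) : nat :=
  match e with
  | NNum m => m
  | NGet a es => nmem st a (map (neval st) es)
  | NAdd e1 e2 => (neval st e1 + neval st e2)%N
  | NSub e1 e2 => (neval st e1 - neval st e2)%N
  end.

Fixpoint txeval (st : state) (e : texp) : trop R :=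
  match e with
  | TInf => 0
  | TZero => 1
  | TGet a es => tmem st a (map (neval st) es)
  | TMin e1 e2 => txeval st e1 + txeval st e2
  | TAdd e1 e2 => txeval st e1 * txeval st e2
  end.

Definition beval (st : state) (b : bexp) : bool :=
  match b with
  | NLe e1 e2 => (neval st e1 <= neval st e2)%N
  | TLe e1 e2 => tle (txeval st e1) (txeval st e2)
  end.

Definition upd (V : Type) (mem : nat -> seq nat -> V) (a : nat) (idx : seq nat)
    (x : V) : nat -> seq nat -> V :=
  fun a' idx' => if (a' == a) && (idx' == idx) then x else mem a' idx'.

(* [exec c st st' t]: started in st, c halts in st' after t units of time.    *)
Inductive exec : cmd -> state -> state -> nat -> Prop :=
  | ExecSkip st : exec Skip st st 1
  | ExecNSet st a es e :
      exec (NSet a es e) st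
        (State (upd (nmem st) a (map (neval st) es) (neval st e)) (tmem st))
        (sumn (map ncost es) + ncost e).+1
  | ExecTSet st a es e :
      exec (TSet a es e) st
        (State (nmem st) (upd (tmem st) a (map (neval st) es) (txeval st e)))
        (sumn (map ncost es) + tcost e).+1
  | ExecSeq c1 c2 st1 st2 st3 t1 t2 :
      exec c1 st1 st2 t1 -> exec c2 st2 st3 t2 ->
      exec (Seq c1 c2) st1 st3 (t1 + t2)
  | ExecIf b c1 c2 st st' t :
      exec (if beval st b then c1 else c2) st st' t ->
      exec (If b c1 c2) st st' (bcost b + t)
  | ExecWhileFalse b c st :
      ~~ beval st b -> exec (While b c) st st (bcost b)
  | ExecWhileTrue b c st1 st2 st3 t1 t2 :
      beval st1 b -> exec c st1 st2 t1 -> exec (While b c) st2 st3 t2 ->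
      exec (While b c) st1 st3 (bcost b + t1 + t2).

Variables k n : nat.

(* D is passed as n, k and, for each pair (u, v), the coefficient of d_uv in  *)
(* T together with 0 if d_uv is a constant and with i + 1 if it contains x_i. *)
(* The remaining cells are not assumed to be initialized.                     *)
Definition input_state (D : 'M[tpoly R k]_n) (st : state) : Prop :=
  [/\ nmem st 0 [::] = n,
      nmem st 1 [::] = k
    & forall u v : 'I_n,
        if nmem st 2 [:: val u; val v] is i.+1 then
          exists (j : 'I_k) (l : R),
            [/\ val j = i, tmem st 0 [:: val u; val v] = Some l
              & D u v = tconst k (Some l) * tvar R j]
        else D u v = tconst k (tmem st 0 [:: val u; val v])].

(* An entry is returned as the list of its terms: their number, and for each  *)
(* of them its coefficient and its exponent vector.                           *)
Definition output_matrix (st : state) : 'M[tpoly R k]_n :=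
  \matrix_(u, v) \sum_(j < nmem st 3 [:: val u; val v])
    tconst k (tmem st 1 [:: val u; val v; val j]) *
    \prod_(i < k) tvar R i ^+ nmem st 4 [:: val u; val v; val j; val i].

End Machine.

(* Main.v *)
(* A path uses every indeterminate at most once, so its weight is determined  *)
(* up to a constant by a set of indeterminates, and two paths with the same   *)
(* set are comparable: this gives the bound 2 ^ k.                            *)
(*                                                                            *)
(* For the Kleene star it suffices to return, for every pair of nodes, a sum  *)
(* of weights of walks that bounds all simple paths from below.  At feasible  *)
(* parameters both this sum and (I + D)^(n-1) equal the minimum over the      *)
(* simple paths, since cycles can be removed.  The distances C with respect   *)
(* to the constant arcs come from Floyd-Warshall in O(n^3), and the walks     *)
(* using exactly a set j of indeterminates from the Held-Karp recursion       *)
(*   M_j(u, v) = min_{i in j} C(u, s_i) + lambda_i + M_{j \ i}(t_i, v),       *)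
(* where s_i -> t_i is the arc of x_i, in O(k 2^k n^2).  The entries of C and *)
(* M_j are weights of walks by construction, so negative constants on cycles  *)
(* do no harm.                                                                *)

From HB Require Import structures.
Require Import Defs.
From mathcomp Require Import all_boot all_order all_algebra.
From mathcomp Require Import reals boolp zify.

Set Implicit Arguments.
Unset Strict Implicit.
Unset Printing Implicit Defensive.

Import Order.TTheory GRing.Theory Num.Theory.
Local Open Scope ring_scope.

(** * Tropical numbers, polynomials and walks *)

(** No indeterminate sits on two arcs, and a simple path leaves each node at most once, so it meets
    each indeterminate at most once ([walk_vars_uniq]). Two simple paths with the same set of
    indeterminates thus have weights that are constants times the same squarefree monomial.
    Constants are totally ordered, so incomparable paths yield distinct subsets of the [k]
    indeterminates ([incomparable_paths_bound]).

    The output is judged by a sandwich ([represents_kleene_starI]): a matrix whose entries are sums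
    of weights of walks and bound all simple paths from below evaluates, at feasible parameters, to
    the minimum over the simple paths; [(1 + D) ^+ n.-1] is such a matrix too. The lower bounds come
    from [bounds_inner_step] for constant arcs and from [path_bound] for sets of indeterminates.
    That every table entry stems from walks is an invariant of the program.

    The judgement [runs], with the loop rules [runs_for] and [runs_for_nodes], yields correctness
    and step count together; [program_cost_le] absorbs the costs of all phases into one constant. *)

Section TropicalOrder.
Variable R : realType.
Implicit Types a b c d : trop R.

(** The natural order of an idempotent semiring: comparisons become equations, which can be
    multiplied by a common monomial. *)
Lemma tleE a b : tle a b = (a + b == a).
Proof.
case: a b => [x|] [y|] //.
  by rewrite /= -[x <= y]eq_minl.
by apply/esym/eqP.
Qed.

Lemma tle_refl a : tle a a.
Proof. by case: a => [x|] //=. Qed.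

Lemma tle_trans b a c : tle a b -> tle b c -> tle a c.
Proof. by case: a b c => [x|] [y|] [z|] //=; apply: le_trans. Qed.

Lemma tle_anti a b : tle a b -> tle b a -> a = b.
Proof.
case: a b => [x|] [y|] //= ab ba.
by congr Some; apply/le_anti; rewrite ab ba.
Qed.

Lemma tle_total a b : tle a b || tle b a.
Proof. by case: a b => [x|] [y|] //=; apply: le_total. Qed.

Lemma tle_addl a b : tle (a + b) a.
Proof. by case: a b => [x|] [y|] //=; rewrite ?ge_min ?lexx. Qed.

Lemma tle_addr a b : tle (a + b) b.
Proof. by rewrite addrC tle_addl. Qed.

Lemma tle_mul a b c d : tle a b -> tle c d -> tle (a * c) (b * d).
Proof. by case: a b c d => [x|] [y|] [z|] [t|] //=; apply: lerD. Qed.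

Lemma tle_sum (I : eqType) (r : seq I) (F : I -> trop R) i :
  i \in r -> tle (\sum_(j <- r) F j) (F i).
Proof.
elim: r => //= j r IH; rewrite inE big_cons => /orP[/eqP <-|/IH].
  exact: tle_addl.
by apply: tle_trans; apply: tle_addr.
Qed.

Lemma tle_sumP (I : eqType) (r : seq I) (F : I -> trop R) c :
  (forall j, j \in r -> tle c (F j)) -> tle c (\sum_(j <- r) F j).
Proof.
elim: r => [|j r IH] cF; first by rewrite big_nil; case: c {cF}.
rewrite big_cons; have := cF j (mem_head _ _).
have : tle c (\sum_(j <- r) F j) by apply: IH => i ir; apply: cF; rewrite inE ir orbT.
case: (F j) (\sum_(j <- r) F j) c {IH cF} => [x|] [y|] [z|] //= yz xz.
by rewrite le_min xz yz.
Qed.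

End TropicalOrder.

(** * Evaluation of tropical polynomials as a semiring morphism *)

Section TropicalPolynomials.
Variable R : realType.
Implicit Types k : nat.

Lemma tconst0 k : tconst k (0 : trop R) = 0.
Proof. by elim: k => //= k ->; rewrite polyC0. Qed.

Lemma tconst1 k : tconst k (1 : trop R) = 1.
Proof. by elim: k => //= k ->; rewrite polyC1. Qed.

Lemma tconstD k : {morph @tconst R k : a b / a + b}.
Proof. by elim: k => //= k IH a b; rewrite IH polyCD. Qed.

Lemma tconstM k : {morph @tconst R k : a b / a * b}.
Proof. by elim: k => //= k IH a b; rewrite IH polyCM. Qed.

(** Additivity and multiplicativity go through one induction, because [map_poly] respects products
    only when the evaluation of the coefficients is packed as a full morphism. *)
Lemma teval_morphism k (z : 'I_k -> trop R) :
  nmod_morphism (fun f : tpoly R k => teval f z) *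
  monoid_morphism (fun f : tpoly R k => teval f z).
Proof.
elim: k z => [|k IH] z //=.
have [fA fM] := IH (fun j => z (lift ord_max j)).
pose aM := GRing.isNmodMorphism.Build _ _ _ fA.
pose mM := GRing.isMonoidMorphism.Build _ _ _ fM.
pose g : {rmorphism tpoly R k -> trop R} := HB.pack (fun f => teval f _) aM mM.
split; split.
- by rewrite (rmorph0 (map_poly g)) horner0.
- by move=> a b; rewrite (rmorphD (map_poly g)) hornerD.
- by rewrite (rmorph1 (map_poly g)) hornerC.
by move=> a b; rewrite (rmorphM (map_poly g)) hornerM.
Qed.

Section Eval.
Variables (k : nat) (z : 'I_k -> trop R).

Lemma teval0 : teval (0 : tpoly R k) z = 0.
Proof. exact: (teval_morphism z).1.1. Qed.

Lemma teval1 : teval (1 : tpoly R k) z = 1.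
Proof. exact: (teval_morphism z).2.1. Qed.

Lemma tevalD (f g : tpoly R k) : teval (f + g) z = teval f z + teval g z.
Proof. exact: (teval_morphism z).1.2. Qed.

Lemma tevalM (f g : tpoly R k) : teval (f * g) z = teval f z * teval g z.
Proof. exact: (teval_morphism z).2.2. Qed.

Lemma teval_sum (I : Type) (r : seq I) (F : I -> tpoly R k) :
  teval (\sum_(i <- r) F i) z = \sum_(i <- r) teval (F i) z.
Proof.
elim/big_rec2: _ => [|i a b _ <-]; [exact: teval0 | exact: tevalD].
Qed.

End Eval.

End TropicalPolynomials.

(** * Sums of weights of walks and the Kleene star *)

Section Walks.
Variables (R : realType) (k n : nat).
Implicit Types (f g : tpoly R k) (D P : 'M[tpoly R k]_n) (u v w : 'I_n).

(** Only this direction holds in general, since distinct polynomials may define the same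
    function. *)
Lemma tpoly_le_absorb f g : f + g = f -> tpoly_le f g.
Proof. by move=> fg z; rewrite tleE -tevalD fg. Qed.

Lemma weight_cat D u s1 s2 :
  weight D u (s1 ++ s2) = weight D u s1 * weight D (last u s1) s2.
Proof. by elim: s1 u => [|w s1 IH] u /=; rewrite ?mul1r // IH mulrA. Qed.

Definition sum_of_walks D u v f : Prop :=
  exists2 ws : seq (seq 'I_n),
    all (is_walk u v) ws & f = \sum_(s <- ws) weight D u s.

Lemma sum_of_walks0 D u v : sum_of_walks D u v 0.
Proof. by exists [::]; rewrite ?big_nil. Qed.

Lemma sum_of_walks_weight D u s : sum_of_walks D u (last u s) (weight D u s).
Proof. by exists [:: s]; rewrite ?big_seq1 //= /is_walk eqxx. Qed.

Lemma sum_of_walksD D u v f g :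
  sum_of_walks D u v f -> sum_of_walks D u v g -> sum_of_walks D u v (f + g).
Proof.
move=> [ws1 h1 ->] [ws2 h2 ->]; exists (ws1 ++ ws2); last by rewrite big_cat.
by rewrite all_cat h1.
Qed.

Lemma sum_of_walks_sum D u v (I : Type) (r : seq I) (F : I -> tpoly R k) :
  (forall i, sum_of_walks D u v (F i)) -> sum_of_walks D u v (\sum_(i <- r) F i).
Proof.
move=> DF; elim/big_ind: _ => // [|f g]; first exact: sum_of_walks0.
exact: sum_of_walksD.
Qed.

Lemma sum_of_walksM D u v w f g :
  sum_of_walks D u v f -> sum_of_walks D v w g -> sum_of_walks D u w (f * g).
Proof.
move=> [ws1 h1 ->] [ws2 h2 ->]; rewrite big_distrl /=.
exists [seq s1 ++ s2 | s1 <- ws1, s2 <- ws2].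
  apply/allP => _ /allpairsP[[s1 s2] [/= /(allP h1)/eqP e1 /(allP h2)/eqP e2 ->]].
  by rewrite /is_walk last_cat e1 e2.
rewrite big_allpairs_dep big_seq [RHS]big_seq; apply: eq_bigr => s1 /(allP h1)/eqP e1.
by rewrite big_distrr; apply: eq_bigr => s2 _; rewrite weight_cat e1.
Qed.

Lemma sum_of_walks_arc D u v : sum_of_walks D u v (D u v).
Proof. by have := sum_of_walks_weight D u [:: v]; rewrite /= mulr1. Qed.

Lemma sum_of_walks1 D u : sum_of_walks D u u 1.
Proof. exact: (sum_of_walks_weight D u [::]). Qed.

(* Removing the cycle that a new first arc may close does not increase the    *)
(* weight at feasible parameters.                                             *)
Lemma feasible_path D z u s : feasible D z ->
  exists2 p, is_path u (last u s) p &
    tle (teval (weight D u p) z) (teval (weight D u s) z).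
Proof.
move=> Dz; elim: s u => [|w s IH] u.
  by exists [::]; rewrite ?tle_refl // /is_path /is_walk eqxx.
have [p /andP[/eqP p_end p_uniq] le_ps] := IH w.
have le_wps : tle (teval (weight D u (w :: p)) z) (teval (weight D u (w :: s)) z).
  by rewrite /= !tevalM; apply: tle_mul; rewrite ?tle_refl.
have [u_in|u_out] := boolP (u \in w :: p); last first.
  exists (w :: p) => //.
  by rewrite /is_path /is_walk /= p_end eqxx u_out.
have [p1 [p2 def_p]] : exists p1 p2, w :: p = p1 ++ u :: p2.
  by case/splitPr: u_in => p1 p2; exists p1, p2.
have last_p2 : last u p2 = last w s.
  by rewrite -p_end -[last w p]/(last u (w :: p)) def_p last_cat.
move: p_uniq le_wps; rewrite def_p -cat_rcons weight_cat last_rcons tevalM.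
rewrite cat_rcons cat_uniq => /and3P[p1_uniq /hasPn p1_disj p2_uniq] le_wps.
exists p2; first by rewrite /is_path /is_walk last_p2 eqxx p2_uniq.
apply: tle_trans le_wps; rewrite -{1}[teval (weight D u p2) z]mul1r.
apply: tle_mul (tle_refl _); apply: Dz => /=.
by rewrite p1_uniq andbT; apply: p1_disj; rewrite mem_head.
Qed.

(** Each walk in [f] can be shortened to a path by [feasible_path], and [g] lies below that path. *)
Lemma eval_sum_of_walks D z u v f g : feasible D z ->
  sum_of_walks D u v f ->
  (forall p, is_path u v p -> tpoly_le g (weight D u p)) ->
  tle (teval g z) (teval f z).
Proof.
move=> Dz [ws /allP ws_walk ->] g_le; rewrite teval_sum.
apply: tle_sumP => s /ws_walk/eqP s_end.
have [p p_path] := feasible_path u s Dz; apply: tle_trans.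
by apply: g_le; rewrite -s_end.
Qed.

Lemma powerD_sum_of_walks D m u v : sum_of_walks D u v (((1 + D) ^+ m) u v).
Proof.
elim: m u v => [|m IH] u v.
  rewrite expr0 !mxE; case: eqP => [->|_]; first exact: sum_of_walks1.
  exact: sum_of_walks0.
rewrite exprS mxE; apply: sum_of_walks_sum => w.
apply: sum_of_walksM (IH w v); rewrite !mxE.
apply: sum_of_walksD (sum_of_walks_arc D u w).
by case: eqP => [->|_]; [exact: sum_of_walks1|exact: sum_of_walks0].
Qed.

Lemma tpoly_le_sum (I : eqType) (r : seq I) (F : I -> tpoly R k) i :
  i \in r -> tpoly_le (\sum_(j <- r) F j) (F i).
Proof.
move=> ir z; rewrite teval_sum.
exact: (@tle_sum _ _ _ (fun j => teval (F j) z)).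
Qed.

(** The diagonal of [1 + D] allows waiting at a node for free, so a walk with fewer than [m] arcs is
    padded at its end. *)
Lemma powerD_le D m u s : (size s <= m)%N ->
  tpoly_le (((1 + D) ^+ m) u (last u s)) (weight D u s).
Proof.
elim: m u s => [|m IH] u [|w s] //= s_le z.
- by rewrite expr0 !mxE eqxx tle_refl.
- rewrite exprS mxE.
  have := tpoly_le_sum (fun w => (1 + D) u w * ((1 + D) ^+ m) w u)
    (mem_index_enum u) z.
  move/tle_trans; apply; rewrite tevalM -[teval 1 z]mul1r.
  apply: tle_mul; last exact: (IH u [::]).
  by rewrite !mxE eqxx tevalD teval1 tle_addl.
rewrite exprS mxE.
have := tpoly_le_sum (fun w' => (1 + D) u w' * ((1 + D) ^+ m) w' (last w s))
  (mem_index_enum w) z.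
move/tle_trans; apply; rewrite !tevalM; apply: tle_mul; last exact: IH.
by rewrite !mxE tevalD tle_addr.
Qed.

(** A path has at most [n] distinct nodes, hence at most [n.-1] arcs. *)
Lemma kleene_star_le D u v p :
  is_path u v p -> tpoly_le (kleene_star D u v) (weight D u p).
Proof.
case/andP=> /eqP <- /card_uniqP /= p_uniq; apply: powerD_le.
have := max_card (mem (u :: p)); rewrite p_uniq card_ord => lt_pn.
by rewrite -ltnS (ltn_predK lt_pn).
Qed.

(** The Kleene star satisfies the two conditions imposed on [P], so at feasible parameters each of
    the two matrices is below the other. *)
Lemma represents_kleene_starI D P :
  (forall u v, sum_of_walks D u v (P u v)) ->
  (forall u v p, is_path u v p -> tpoly_le (P u v) (weight D u p)) ->
  represents_kleene_star D P.
Proof.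
move=> P_walks P_le; split=> // z Dz u v; apply: tle_anti.
  exact: eval_sum_of_walks Dz (powerD_sum_of_walks D _ u v) (P_le u v).
exact: eval_sum_of_walks Dz (P_walks u v) (@kleene_star_le D u v).
Qed.

End Walks.

(** * Sets of indeterminates as binary numbers *)

Section Bits.
Local Open Scope nat_scope.

(* A set of indeterminates is encoded by the number with these binary digits. *)
Definition bit (j i : nat) : bool := odd (j %/ 2 ^ i).

Lemma bits_exist k (f : nat -> bool) :
  exists2 j, (j < 2 ^ k)%N & forall i, (i < k)%N -> bit j i = f i.
Proof.
elim: k f => [|k IH] f; first by exists 0%N.
have [j lt_j j_bits] := IH (f \o succn).
exists (f 0%N + j.*2)%N.
  by rewrite expnS mul2n -ltn_half_double half_bit_double.
case=> [_|i /j_bits/= <-].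
  by rewrite /bit divn1 oddD odd_double addbF oddb.
by rewrite /bit expnS divnMA divn2 half_bit_double.
Qed.

(** Stripping the top digit of a residue: together with [bit_modn], this lets the program decode a
    set by comparisons and subtractions alone. *)
Lemma modn_bit j m : j %% 2 ^ m.+1 = (bit j m * 2 ^ m + j %% 2 ^ m)%N.
Proof.
have def_j : j = (j %/ 2 ^ m)./2 * 2 ^ m.+1 + (bit j m * 2 ^ m + j %% 2 ^ m).
  rewrite {1}(divn_eq j (2 ^ m)) -{1}[j %/ 2 ^ m]odd_double_half -/(bit j m).
  by rewrite mulnDl -muln2 -mulnA -expnS addnCA addnA.
rewrite {1}def_j modnMDl modn_small // expnS mul2n -addnn -addnS.
by apply: leq_add; rewrite ?ltn_mod ?expn_gt0 //; case: (bit j m); rewrite ?mul1n.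
Qed.

Lemma bit_modn j m : bit j m = (2 ^ m <= j %% 2 ^ m.+1)%N.
Proof.
rewrite modn_bit; case: (bit j m); first by rewrite mul1n leq_addr.
by rewrite leqNgt ltn_mod expn_gt0.
Qed.

Lemma bit_leq j i : bit j i -> (2 ^ i <= j)%N.
Proof. by rewrite bit_modn => /leq_trans; apply; apply: leq_mod. Qed.

Lemma bits_eq0 k j : (j < 2 ^ k)%N ->
  (forall i, (i < k)%N -> ~~ bit j i) -> j = 0%N.
Proof.
move=> lt_j j_bits; rewrite -(modn_small lt_j) {lt_j}.
elim: k j_bits => [|k IH] j_bits; first by rewrite modn1.
rewrite modn_bit (negbTE (j_bits k (ltnSn k))) mul0n add0n; apply: IH => i ik.
by apply: j_bits; apply: ltnW.
Qed.

Lemma bit_sub j i m : bit j i -> bit (j - 2 ^ i) m = bit j m && (m != i).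
Proof.
move=> ji; have le_ij := bit_leq ji; have gt0 a : (0 < 2 ^ a)%N by rewrite expn_gt0.
have [le_mi|lt_im] := leqP m i.
  (* Up to position [i], the quotient by [2 ^ m] drops by [2 ^ (i - m)], which is odd only for
     [m = i]. *)
  have def_i : (2 ^ i = 2 ^ (i - m) * 2 ^ m)%N by rewrite -expnD subnK.
  rewrite {1}/bit def_i divnBMl oddB; last first.
    by rewrite leq_divRL // -def_i.
  rewrite -/(bit j m) oddX orbF subn_eq0 eqn_leq le_mi /=.
  have [le_im|_] := leqP i m; last by rewrite andbT addbF.
  by rewrite (_ : m = i) ?ji //; apply/eqP; rewrite eqn_leq le_mi.
(* Above position [i], the quotient [j %/ 2 ^ i] is odd, so taking one away does not change its
   half. *)
have -> : m = (i + (m - i).-1.+1)%N by rewrite prednK ?subn_gt0 // subnKC // ltnW.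
rewrite gtn_eqF ?leq_addr // ?andbT; last by rewrite addnS ltnS leq_addr.
rewrite /bit expnD !divnMA expnS !divnMA !divn2.
rewrite -[X in j - X]mul1n divnBMl subn1; move: ji; rewrite /bit.
by case: (j %/ 2 ^ i) => //= q /negbTE q_even; rewrite uphalf_half q_even.
Qed.

Definition monomial (R : realType) k j : tpoly R k :=
  \prod_(i < k) tvar R i ^+ bit j i.

Lemma monomial0 (R : realType) k : monomial R k 0 = 1%R.
Proof. by apply: big1 => i _; rewrite /bit div0n expr0. Qed.

Lemma monomial_sub (R : realType) k j (i : 'I_k) : bit j i ->
  monomial R k j = (tvar R i * monomial R k (j - 2 ^ i))%R.
Proof.
move=> ji; rewrite /monomial (bigD1 i) //= [in RHS](bigD1 i) //=.
rewrite bit_sub // ji eqxx expr1 mul1r; congr (_ * _)%R.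
by apply: eq_bigr => m m_neq; rewrite bit_sub // val_eqE m_neq andbT.
Qed.

Lemma prod_tvar (R : realType) k j (r : seq 'I_k) : uniq r ->
  (forall i : 'I_k, bit j i = (i \in r)) ->
  (\prod_(i <- r) tvar R i)%R = monomial R k j.
Proof.
move=> r_uniq jr; rewrite big_uniq //= big_mkcond; apply: eq_bigr => i _.
by rewrite jr; case: ifP; rewrite ?expr1 ?expr0.
Qed.

End Bits.

(** * Coefficients and indeterminates of paths; the two recursions *)

Section LabelledArcs.
Variables (R : realType) (k n : nat).
Implicit Types (D : 'M[tpoly R k]_n) (u v w : 'I_n) (s : seq 'I_n).

(* A missing arc is encoded by co u v = oo.                                   *)
Definition arc_labels D (co : 'I_n -> 'I_n -> trop R)
    (va : 'I_n -> 'I_n -> option 'I_k) : Prop :=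
  (forall u v, D u v = tconst k (co u v) * oapp (@tvar R k) 1 (va u v)) /\
  (forall i u v u' v', va u v = Some i -> va u' v' = Some i ->
     u = u' /\ v = v').

Lemma separated_arc_labels D :
  separated_variables D -> exists co va, arc_labels D co va.
Proof.
move=> [D_arcs D_inj].
pose lab u v (x : trop R * option 'I_k) :=
  D u v = tconst k x.1 * oapp (@tvar R k) 1 x.2 /\
  (forall i, x.2 = Some i -> occurs i (D u v)).
have ex_lab (uv : 'I_n * 'I_n) : exists x, lab uv.1 uv.2 x.
  case: (D_arcs uv.1 uv.2) => [D0|[l Dl]|[i occ_i]].
  - by exists (0, None); split=> //=; rewrite D0 tconst0 mul0r.
  - by exists (Some l, None); split=> //=; rewrite Dl mulr1.
  by have [l Dl] := occ_i; exists (Some l, Some i); split=> //= j [<-].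
have [f f_lab] := choice ex_lab.
exists (fun u v => (f (u, v)).1), (fun u v => (f (u, v)).2); split=> [u v|].
  by case: (f_lab (u, v)).
move=> i u v u' v' fi fi'; apply: (D_inj i).
  exact: (proj2 (f_lab (u, v))).
exact: (proj2 (f_lab (u', v'))).
Qed.

Section Paths.
Variables (co : 'I_n -> 'I_n -> trop R) (va : 'I_n -> 'I_n -> option 'I_k).

Fixpoint walk_coef u s : trop R :=
  if s is w :: s' then co u w * walk_coef w s' else 1.

Fixpoint walk_vars u s : seq 'I_k :=
  if s is w :: s' then oapp cons id (va u w) (walk_vars w s') else [::].

Lemma walk_coef_cat u s1 s2 :
  walk_coef u (s1 ++ s2) = walk_coef u s1 * walk_coef (last u s1) s2.
Proof. by elim: s1 u => [|w s1 IH] u /=; rewrite ?mul1r // IH mulrA. Qed.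

Lemma walk_vars_cat u s1 s2 :
  walk_vars u (s1 ++ s2) = walk_vars u s1 ++ walk_vars (last u s1) s2.
Proof. by elim: s1 u => [|w s1 IH] u //=; rewrite IH; case: (va u w). Qed.

Variable D : 'M[tpoly R k]_n.
Hypothesis D_lab : arc_labels D co va.

Lemma weightE u s :
  weight D u s = tconst k (walk_coef u s) * \prod_(i <- walk_vars u s) tvar R i.
Proof.
elim: s u => [|w s IH] u /=; first by rewrite tconst1 big_nil mulr1.
rewrite IH (proj1 D_lab) tconstM; case: (va u w) => [i|] /=.
  by rewrite big_cons mulrACA.
by rewrite mulr1 mulrA.
Qed.

Lemma walk_varsP u s i : i \in walk_vars u s ->
  exists s1 w s2, s = s1 ++ w :: s2 /\ va (last u s1) w = Some i.
Proof.
elim: s u => [|w s IH] u //=; case def_j: (va u w) => [j|] /=; last first.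
  by move/IH=> [s1 [x [s2 [-> ?]]]]; exists (w :: s1), x, s2.
rewrite inE => /orP[/eqP ->|]; first by exists [::], w, s.
by move/IH=> [s1 [x [s2 [-> ?]]]]; exists (w :: s1), x, s2.
Qed.

(** A second occurrence of an indeterminate would lie on the same arc, so the path would visit the
    tail of that arc twice. *)
Lemma walk_vars_uniq u s : uniq (u :: s) -> uniq (walk_vars u s).
Proof.
elim: s u => [|w s IH] u //= /andP[u_out /IH s_uniq].
case def_i: (va u w) => [i|] //=; rewrite s_uniq andbT.
apply/negP => /walk_varsP[s1 [x [s2 [def_s def_i']]]].
have [def_u _] := proj2 D_lab _ _ _ _ _ def_i def_i'.
case/negP: u_out; rewrite def_u def_s; have := mem_last w s1.
by rewrite !inE mem_cat => /orP[->|->]; rewrite ?orbT.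
Qed.

Lemma incomparable_paths_bound u v (ps : seq (seq 'I_n)) :
  uniq ps -> (forall p, p \in ps -> is_path u v p) ->
  (forall p q, p \in ps -> q \in ps -> p <> q ->
     incomparable (weight D u p) (weight D u q)) ->
  (size ps <= 2 ^ k)%N.
Proof.
move=> ps_uniq ps_path ps_inc.
pose A p := [set i in walk_vars u p].
have weightA p : p \in ps ->
    weight D u p = tconst k (walk_coef u p) * \prod_(i in A p) tvar R i.
  move/ps_path => /andP[_ /walk_vars_uniq p_uniq].
  rewrite weightE big_uniq //=; congr (_ * _).
  by apply: eq_bigl => i; rewrite inE.
have A_inj : {in ps &, injective A}.
  move=> p q p_in q_in eqA; have [//|/eqP/(ps_inc p q p_in q_in)[pq qp]] := eqVneq p q.
  case/orP: (tle_total (walk_coef u p) (walk_coef u q)); rewrite tleE => /eqP le.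
    case: pq; apply: tpoly_le_absorb.
    by rewrite !weightA // eqA -mulrDl -tconstD le.
  case: qp; apply: tpoly_le_absorb.
  by rewrite !weightA // eqA -mulrDl -tconstD le.
rewrite -(size_map A) -[k in (2 ^ k)%N]card_ord -cardsT -card_powerset.
have /card_uniqP <- : uniq (map A ps) by rewrite map_inj_in_uniq.
by apply/subset_leq_card/subsetP => B _; rewrite powersetE subsetT.
Qed.

(* The invariant of Floyd-Warshall.  Restricting it to simple paths makes it  *)
(* insensitive to negative cycles.                                            *)
Definition bounds_inner m (C : 'I_n -> 'I_n -> trop R) : Prop :=
  forall u v s, uniq (u :: rcons s v) -> all (fun w : 'I_n => w < m)%N s ->
    walk_vars u (rcons s v) = [::] -> tle (C u v) (walk_coef u (rcons s v)).

(** A simple path meets [w] at most once, and both pieces have their inner nodes below [w]. Only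
    upper bounds on [C'] are asked for, which suits a table that is updated in place. *)
Lemma bounds_inner_step (w : 'I_n) C C' :
  bounds_inner w C ->
  (forall u v, tle (C' u v) (C u v)) ->
  (forall u v, tle (C' u v) (C u w * C w v)) ->
  bounds_inner w.+1 C'.
Proof.
move=> C_le C'C C'w u v s uniq_s s_lt s_const.
have [w_in|w_out] := boolP (w \in s); last first.
  apply: tle_trans (C'C u v) (C_le _ _ _ uniq_s _ s_const).
  apply/allP => x xs; move/allP/(_ x xs): s_lt; rewrite ltnS leq_eqVlt.
  by case/orP=> // /eqP/val_inj eq_xw; rewrite -eq_xw xs in w_out.
case/splitPr: w_in uniq_s s_lt s_const => s1 s2.
rewrite rcons_cat rcons_cons -cat_rcons -cat_cons cat_uniq all_cat /=.
case/and3P=> uniq_1 /hasPn disj uniq_2 /and3P[s1_lt _ s2_lt].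
rewrite walk_vars_cat walk_coef_cat last_rcons => /eqP.
rewrite -size_eq0 size_cat addn_eq0 !size_eq0 => /andP[/eqP const1 /eqP const2].
have not_w s' : w \notin s' -> all (fun x : 'I_n => x < w.+1)%N s' ->
    all (fun x : 'I_n => x < w)%N s'.
  move=> w_out /allP s'_lt; apply/allP => x xs; have := s'_lt x xs.
  rewrite ltnS leq_eqVlt => /orP[/eqP/val_inj eq_xw|//].
  by rewrite -eq_xw xs in w_out.
apply: tle_trans (C'w u v) _; apply: tle_mul; apply: C_le => //.
- apply: not_w s1_lt; move: uniq_1; rewrite /= rcons_uniq.
  by case/and3P.
- rewrite /= uniq_2 andbT; apply/negP => w_in; have := disj w w_in.
  by rewrite /= inE mem_rcons mem_head orbT.
apply: not_w s2_lt; apply/negP => w_in; have := disj w.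
by rewrite mem_rcons inE w_in orbT inE mem_rcons mem_head orbT => /(_ isT).
Qed.

(** The diagonal bound serves the empty path, which [bounds_inner] leaves out. *)
Lemma bounds_inner_all C u s : bounds_inner n C -> tle (C u u) 1 ->
  uniq (u :: s) -> walk_vars u s = [::] -> tle (C u (last u s)) (walk_coef u s).
Proof.
move=> C_le Cuu; case/lastP: s => [//|s v] uniq_s s_const.
by rewrite last_rcons; apply: C_le => //; apply/allP => x _; apply: ltn_ord.
Qed.

Lemma walk_vars_cons u s i r : walk_vars u s = i :: r ->
  exists s1 w s2, [/\ s = s1 ++ w :: s2, walk_vars u s1 = [::],
    va (last u s1) w = Some i & walk_vars w s2 = r].
Proof.
elim: s u => [|w s IH] u //=; case def_j: (va u w) => [j|] /= => [[<- <-]|].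
  by exists [::], w, s.
case/IH=> s1 [x [s2 [-> s1_const def_i def_r]]].
by exists (w :: s1), x, s2; split=> //=; rewrite def_j.
Qed.

(* Held-Karp: a path using the set j of indeterminates runs through constant  *)
(* arcs up to its first arc with an indeterminate i, and its remainder uses   *)
(* the set j - 2 ^ i.                                                         *)
Lemma path_bound C (M : nat -> 'I_n -> 'I_n -> trop R) :
  bounds_inner n C -> (forall u, tle (C u u) 1) ->
  (forall u v, tle (M 0%N u v) (C u v)) ->
  (forall j (i : 'I_k) x y u v, (j < 2 ^ k)%N -> bit j i -> va x y = Some i ->
     tle (M j u v) (C u x * (co x y * M (j - 2 ^ i)%N y v))) ->
  forall j u s, (j < 2 ^ k)%N -> uniq (u :: s) ->
    (forall i : 'I_k, bit j i = (i \in walk_vars u s)) ->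
    tle (M j u (last u s)) (walk_coef u s).
Proof.
move=> C_le Cuu M0 Mstep j u s.
move def_r: (walk_vars u s) => r.
elim: r j u s def_r => [|i r IH] j u s def_r j_lt s_uniq js.
  have -> : j = 0%N.
    by apply: bits_eq0 j_lt _ => i ik; rewrite -[i]/(val (Ordinal ik)) js.
  by apply: tle_trans (M0 _ _) _; apply: bounds_inner_all.
have [s1 [w [s2 [def_s s1_const def_i s2_vars]]]] := walk_vars_cons def_r.
have ji : bit j i by rewrite js mem_head.
have := walk_vars_uniq s_uniq; rewrite def_r => /andP[i_out _].
move: s_uniq; rewrite def_s -cat_cons cat_uniq => /and3P[s1_uniq _ s2_uniq].
rewrite last_cat walk_coef_cat; apply: tle_trans (Mstep _ _ _ _ _ _ j_lt ji def_i) _.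
apply: tle_mul; first exact: bounds_inner_all.
apply: tle_mul (tle_refl _) _; apply: IH => // [|m].
  by apply: leq_ltn_trans j_lt; apply: leq_subr.
rewrite bit_sub // js inE -val_eqE; case: eqP => [/val_inj ->|] /=.
  by rewrite (negbTE i_out).
by rewrite andbT.
Qed.

(** A path is bounded by a single term, the one whose number encodes the indeterminates of the path;
    of the other terms it only matters that they come from walks. *)
Lemma representsI (M : nat -> 'I_n -> 'I_n -> trop R) :
  (forall j u v, (j < 2 ^ k)%N ->
     sum_of_walks D u v (tconst k (M j u v) * monomial R k j)) ->
  (forall j u s, (j < 2 ^ k)%N -> uniq (u :: s) ->
     (forall i : 'I_k, bit j i = (i \in walk_vars u s)) ->
     tle (M j u (last u s)) (walk_coef u s)) ->
  represents_kleene_star D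
    (\matrix_(u, v) \sum_(j < 2 ^ k) tconst k (M j u v) * monomial R k j).
Proof.
move=> M_walks M_le; apply: represents_kleene_starI => [u v|u v p].
  by rewrite mxE; apply: sum_of_walks_sum => j; apply: M_walks.
case/andP=> /eqP <- p_uniq; rewrite mxE weightE => z.
have [j j_lt jp] := bits_exist k (fun i => [exists m in walk_vars u p, val m == i]).
have {}jp (i : 'I_k) : bit j i = (i \in walk_vars u p).
  rewrite jp //; apply/exists_inP/idP => [[m m_in /eqP/val_inj <-]//|i_in].
  by exists i.
rewrite (prod_tvar _ (walk_vars_uniq p_uniq) jp).
have := tpoly_le_sum
  (fun j : 'I_(2 ^ k) => tconst k (M j u (last u p)) * monomial R k j)
  (mem_index_enum (Ordinal j_lt)) z.
move/tle_trans; apply.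
apply: tpoly_le_absorb; rewrite -mulrDl -tconstD; congr (tconst k _ * _).
by apply/eqP; rewrite -tleE; apply: M_le.
Qed.

End Paths.

End LabelledArcs.

(** * Running times of commands *)

Section Commands.
Variable R : realType.
Local Open Scope nat_scope.
Implicit Types (st : state R) (c : cmd) (Q : state R -> Prop).

Fixpoint nat_writes c : seq nat :=
  match c with
  | NSet a _ _ => [:: a]
  | Seq c1 c2 | If _ c1 c2 => nat_writes c1 ++ nat_writes c2
  | While _ c1 => nat_writes c1
  | _ => [::]
  end.

Fixpoint trop_writes c : seq nat :=
  match c with
  | TSet a _ _ => [:: a]
  | Seq c1 c2 | If _ c1 c2 => trop_writes c1 ++ trop_writes c2
  | While _ c1 => trop_writes c1
  | _ => [::]
  end.

(** The frame condition of the rules below. It tracks whole arrays rather than cells, so that it can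
    be read off the text of a command. *)
Definition agree_off (na ta : seq nat) st st' : Prop :=
  (forall a, a \notin na -> nmem st' a = nmem st a) /\
  (forall a, a \notin ta -> tmem st' a = tmem st a).

Lemma upd_off (V : Type) (mem : nat -> seq nat -> V) a idx x a' :
  a' != a -> upd mem a idx x a' = mem a'.
Proof. by rewrite /upd => /negbTE ->. Qed.

Lemma agree_off_trans na ta st1 st2 st3 :
  agree_off na ta st1 st2 -> agree_off na ta st2 st3 -> agree_off na ta st1 st3.
Proof. by move=> [n12 t12] [n23 t23]; split=> a ?; rewrite ?n23 ?t23 ?n12 ?t12. Qed.

Lemma agree_off_sub na ta na' ta' st st' :
  {subset na <= na'} -> {subset ta <= ta'} ->
  agree_off na ta st st' -> agree_off na' ta' st st'.
Proof.
move=> sub_n sub_t [agr_n agr_t].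
by split=> a a_out; [apply: agr_n|apply: agr_t]; apply: contra a_out; auto.
Qed.

Lemma exec_agree_off c st st' t :
  exec c st st' t -> agree_off (nat_writes c) (trop_writes c) st st'.
Proof.
elim=> {c st st' t} //=.
- by move=> st a es e; split=> b //=; rewrite inE; apply: upd_off.
- by move=> st a es e; split=> b //=; rewrite inE; apply: upd_off.
- move=> c1 c2 st1 st2 st3 t1 t2 _ agr12 _ agr23.
  apply: (@agree_off_trans _ _ _ st2).
    by apply: agree_off_sub agr12 => a a_in; rewrite mem_cat a_in.
  by apply: agree_off_sub agr23 => a a_in; rewrite mem_cat a_in orbT.
- move=> b c1 c2 st st' t _; apply: agree_off_sub => a;
  by case: ifP => _ a_in; rewrite mem_cat a_in ?orbT.
- by move=> b c st1 st2 st3 t1 t2 _ _ agr12 _; apply: agree_off_trans.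
Qed.

(** A Hoare triple for total correctness with a time bound. *)
Definition runs c T st Q : Prop :=
  exists st' t, [/\ exec c st st' t, t <= T & Q st'].

Lemma runs_seq c1 c2 T1 T2 st Q :
  runs c1 T1 st (fun st1 => runs c2 T2 st1 Q) -> runs (Seq c1 c2) (T1 + T2) st Q.
Proof.
move=> [st1 [t1 [run1 le1 [st2 [t2 [run2 le2 Q2]]]]]].
by exists st2, (t1 + t2); split; [exact: ExecSeq run1 run2|exact: leq_add|].
Qed.

Lemma runs_if b c1 c2 T st Q :
  runs (if beval st b then c1 else c2) T st Q ->
  runs (If b c1 c2) (bcost b + T) st Q.
Proof.
move=> [st1 [t1 [run1 le1 Q1]]].
by exists st1, (bcost b + t1); rewrite leq_add2l; split=> //; apply: ExecIf.
Qed.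

Lemma runs_weaken c T T' st Q Q' : T <= T' ->
  (forall st', agree_off (nat_writes c) (trop_writes c) st st' -> Q st' -> Q' st') ->
  runs c T st Q -> runs c T' st Q'.
Proof.
move=> leT QQ' [st1 [t1 [run1 le1 Q1]]]; exists st1, t1; split=> //.
  exact: leq_trans le1 leT.
by apply: QQ' Q1; apply: exec_agree_off run1.
Qed.

Fixpoint loopfree c : bool :=
  match c with
  | Seq c1 c2 | If _ c1 c2 => loopfree c1 && loopfree c2
  | While _ _ => false
  | _ => true
  end.

Fixpoint effect c st : state R :=
  match c with
  | NSet a es e =>
      State (upd (nmem st) a (map (neval st) es) (neval st e)) (tmem st)
  | TSet a es e =>
      State (nmem st) (upd (tmem st) a (map (neval st) es) (txeval st e))
  | Seq c1 c2 => effect c2 (effect c1 st)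
  | If b c1 c2 => if beval st b then effect c1 st else effect c2 st
  | _ => st
  end.

(** A crude upper bound: the two branches of a conditional are added. *)
Fixpoint max_cost c : nat :=
  match c with
  | Skip => 1
  | NSet _ es e => (sumn (map ncost es) + ncost e).+1
  | TSet _ es e => (sumn (map ncost es) + tcost e).+1
  | Seq c1 c2 => max_cost c1 + max_cost c2
  | If b c1 c2 => bcost b + (max_cost c1 + max_cost c2)
  | While _ _ => 0
  end.

Lemma runs_loopfree c st Q :
  loopfree c -> Q (effect c st) -> runs c (max_cost c) st Q.
Proof.
elim: c st Q => //= [|a es e|a es e|c1 IH1 c2 IH2|b c1 IH1 c2 IH2] st Q.
- by move=> _ Qst; exists st, 1; split=> //; apply: ExecSkip.
- by move=> _ Qst; do 2!eexists; split; [apply: ExecNSet|exact: leqnn|].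
- by move=> _ Qst; do 2!eexists; split; [apply: ExecTSet|exact: leqnn|].
- by case/andP=> lf1 lf2 Qst; apply: runs_seq; apply: IH1 => //; apply: IH2.
case/andP=> lf1 lf2 Qst; apply: runs_if; case: ifP Qst => _ Qst.
  by apply: (@runs_weaken _ (max_cost c1)) (IH1 _ _ lf1 Qst); rewrite ?leq_addr.
by apply: (@runs_weaken _ (max_cost c2)) (IH2 _ _ lf2 Qst); rewrite ?leq_addl.
Qed.

Definition set_var st a x : state R :=
  State (upd (nmem st) a [::] x) (tmem st).

Definition For a b c : cmd :=
  Seq (NSet a [::] (NNum 0))
    (While (NLe (NAdd (NGet a [::]) (NNum 1)) (NGet b [::]))
       (Seq c (NSet a [::] (NAdd (NGet a [::]) (NNum 1))))).

(* The loop takes at most 7 + N * (T + 9) steps; the cruder product composes  *)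
(* better for nested loops.                                                   *)
Lemma runs_for a b c N T st (Inv : nat -> state R -> Prop) Q :
  a \notin nat_writes c -> b \notin a :: nat_writes c ->
  nmem st b [::] = N ->
  Inv 0 (set_var st a 0) ->
  (forall m st1, m < N ->
     agree_off (a :: nat_writes c) (trop_writes c) st st1 ->
     nmem st1 a [::] = m -> Inv m st1 ->
     runs c T st1 (fun st2 => Inv m.+1 (set_var st2 a m.+1))) ->
  (forall st1, agree_off (a :: nat_writes c) (trop_writes c) st st1 ->
     Inv N st1 -> Q st1) ->
  runs (For a b c) (maxn 1 N * (T + 16)) st Q.
Proof.
move=> a_out b_out st_b Inv0 step post.
have agree_set st1 x :
    agree_off (a :: nat_writes c) (trop_writes c) st1 (set_var st1 a x).
  by split=> // a'; rewrite inE negb_or /= /upd => /andP[/negbTE ->].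
pose loop := While (NLe (NAdd (NGet a [::]) (NNum 1)) (NGet b [::]))
  (Seq c (NSet a [::] (NAdd (NGet a [::]) (NNum 1)))).
(* A test costs 5 and an increment 4, whence [T + 9] for each of the [d] remaining rounds and 5 for
   the final failing test. *)
have loop_runs d m st1 : m + d = N ->
    agree_off (a :: nat_writes c) (trop_writes c) st st1 ->
    nmem st1 a [::] = m -> Inv m st1 -> runs loop (d * (T + 9) + 5) st1 Q.
  elim: d m st1 => [|d IH] m st1 def_N agr st1_a Inv_m.
    exists st1, 5; split=> //; last by apply: post; rewrite // -def_N addn0.
    apply: (@ExecWhileFalse R (NLe (NAdd (NGet a [::]) (NNum 1)) (NGet b [::]))) => /=.
    by rewrite st1_a agr.1 // st_b -def_N addn0 addn1 ltnn.
  have lt_mN : m < N by rewrite -def_N addnS ltnS leq_addr.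
  have [st2 [t2 [run2 le2 Inv2]]] := step m st1 lt_mN agr st1_a Inv_m.
  have agr2 := exec_agree_off run2.
  have st2_a : nmem st2 a [::] = m by rewrite agr2.1.
  have [|||st3 [t3 [run3 le3 Q3]]] := IH m.+1 (set_var st2 a m.+1) _ _ _ Inv2.
  - by rewrite addSnnS.
  - apply: agree_off_trans agr (agree_off_trans _ (agree_set _ _)).
    by apply: agree_off_sub agr2 => // x; rewrite inE orbC => ->.
  - by rewrite /= /upd !eqxx.
  exists st3, (5 + (t2 + 4) + t3); split=> //.
    apply: (@ExecWhileTrue R (NLe (NAdd (NGet a [::]) (NNum 1)) (NGet b [::]))) run3.
      by rewrite /= st1_a agr.1 // st_b addn1.
    apply: ExecSeq run2 _.
    have := @ExecNSet R st2 a [::] (NAdd (NGet a [::]) (NNum 1)).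
    by rewrite /= st2_a addn1.
  lia.
have [||st1 [t1 [run1 le1 Q1]]] :=
  loop_runs N 0 (set_var st a 0) (add0n N) (agree_set _ _).
- by rewrite /= /upd !eqxx.
- by [].
exists st1, (2 + t1); split=> //.
  by apply: ExecSeq run1; apply: (@ExecNSet R st a [::] (NNum 0)).
have : N <= maxn 1 N by rewrite leq_maxr.
have : 0 < maxn 1 N by rewrite leq_maxl.
by nia.
Qed.

(* Cell 0 holds the number of nodes, cells 10 and 11 the current pair.        *)
Definition ForNodes c : cmd := For 10 0 (For 11 0 c).

Definition nodes_cost n c : nat :=
  maxn 1 n * (maxn 1 n * (max_cost c + 16) + 16).

(* Fact is what one run of the body achieves for its pair of nodes; the other *)
(* runs must not destroy it.                                                  *)
Lemma runs_for_nodes n c st (Inv : state R -> Prop)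
    (Fact : 'I_n -> 'I_n -> state R -> Prop) Q :
  loopfree c -> all (fun a => a \notin nat_writes c) [:: 0; 10; 11] ->
  nmem st 0 [::] = n ->
  (forall st1 a x, a \in [:: 10; 11] -> Inv st1 -> Inv (set_var st1 a x)) ->
  (forall u v st1 a x, a \in [:: 10; 11] ->
     Fact u v st1 -> Fact u v (set_var st1 a x)) ->
  Inv st ->
  (forall (u v : 'I_n) st1,
     agree_off [:: 10, 11 & nat_writes c] (trop_writes c) st st1 ->
     nmem st1 10 [::] = u -> nmem st1 11 [::] = v -> Inv st1 ->
     [/\ Inv (effect c st1), Fact u v (effect c st1)
       & forall u' v', Fact u' v' st1 -> Fact u' v' (effect c st1)]) ->
  (forall st1,
     agree_off [:: 10, 11 & nat_writes c] (trop_writes c) st st1 ->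
     Inv st1 -> (forall u v, Fact u v st1) -> Q st1) ->
  runs (ForNodes c) (nodes_cost n c) st Q.
Proof.
move=> lf /and4P[out0 out10 out11 _] st_n Inv_set Fact_set Inv_st step post.
have writes_inner : nat_writes (For 11 0 c) = 11 :: nat_writes c ++ [:: 11] by [].
have writes_outer : {subset 10 :: nat_writes (For 11 0 c) <= [:: 10, 11 & nat_writes c]}.
  move=> a; rewrite writes_inner !inE mem_cat !inE.
  by case: (a == 10); case: (a == 11); rewrite ?orbF.
apply: (@runs_for _ _ _ n _ _ (fun m st1 =>
  Inv st1 /\ forall u v : 'I_n, u < m -> Fact u v st1)).
- by rewrite writes_inner inE mem_cat (negbTE out10).
- by rewrite writes_inner !inE mem_cat (negbTE out0).
- by [].
- by split=> //; apply: Inv_set.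
- move=> m st1 lt_mn agr st1_u [Inv1 Fact1].
  have {}agr : agree_off [:: 10, 11 & nat_writes c] (trop_writes c) st st1.
    by apply: agree_off_sub agr => // a; rewrite /= !cats0 => ->.
  (* Pairs are completed in lexicographic order: the rows before [m], and in row [m] the columns
     before [m2]. *)
  apply: (@runs_for _ _ _ n _ _ (fun m2 st2 => Inv st2 /\
    forall u v : 'I_n, (u < m) || (u == m :> nat) && (v < m2) -> Fact u v st2)).
  + by [].
  + by rewrite inE negb_or out0.
  + by rewrite agr.1 // !inE (negbTE out0).
  + split; first exact: Inv_set.
    by move=> u v; rewrite ltn0 andbF orbF => um; apply: Fact_set => //; apply: Fact1.
  + move=> m2 st2 lt_m2n agr2 st2_v [Inv2 Fact2]; apply: runs_loopfree => //.
    have [||Inv3 Fact3 Fact_keep] :=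
      step (Ordinal lt_mn) (Ordinal lt_m2n) st2 _ _ st2_v Inv2.
    * apply: agree_off_trans agr (agree_off_sub _ _ agr2) => // a a_in.
      by rewrite inE a_in orbT.
    * by rewrite agr2.1 // inE negb_or out10.
    split=> [|u v]; first exact: Inv_set.
    rewrite ltnS (leq_eqVlt v) andb_orr orbCA => /orP[/andP[/eqP um /eqP vm2]|uv].
      rewrite (_ : u = Ordinal lt_mn); last exact: val_inj.
      by rewrite (_ : v = Ordinal lt_m2n); [apply: Fact_set|exact: val_inj].
    by apply: Fact_set => //; apply: Fact_keep; apply: Fact2.
  move=> st2 agr2 [Inv2 Fact2]; split=> [|u v]; first exact: Inv_set.
  rewrite ltnS leq_eqVlt orbC => um; apply: Fact_set => //; apply: Fact2.
  by rewrite ltn_ord andbT.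
move=> st1 agr [Inv1 Fact1]; apply: post Inv1 _ => [|u v]; last exact: Fact1.
by apply: agree_off_sub agr => // a; rewrite /= !cats0 => ->.
Qed.

End Commands.

(** * The program *)

Section Program.
Variable R : realType.
Implicit Types st : state R.

Local Notation "% a" := (NGet a [::]) (at level 0, a at level 0, only parsing).

(* Arrays of numbers:                                                         *)
(*   0, 1, 2    n, k and the indeterminates of the arcs (input)               *)
(*   3, 4       numbers of terms and exponents (output)                       *)
(*   5, 6       tail and head of the arc of an indeterminate                  *)
(*   7, 17      powers of 2, and 2 ^ k                                        *)
(*   10, 11, 12 nodes                                                         *)
(*   13, 16     an indeterminate, counted upwards, resp. downwards            *)
(*   14, 15     a set of indeterminates, and its part yet to be decoded       *)
(* Arrays of elements of T:                                                   *)
(*   0, 1       coefficients of the arcs (input) and of the terms (output)    *)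
(*   2          distances along constant arcs                                 *)
(*   3          coefficient of the arc of an indeterminate                    *)

(* An indeterminate without an arc keeps the coefficient oo, which makes the  *)
(* uninitialized tail and head of its arc harmless.                           *)
Definition init_lam : cmd := For 13 1 (TSet 3 [:: %13] TInf).

Definition powers : cmd :=
  Seq (NSet 7 [:: NNum 0] (NNum 1))
  (Seq (For 13 1
         (NSet 7 [:: NAdd %13 (NNum 1)] (NAdd (NGet 7 [:: %13]) (NGet 7 [:: %13]))))
       (NSet 17 [::] (NGet 7 [:: %1]))).

(** Every entry is announced with [2 ^ k] terms, one for each set of indeterminates. The input
    stores [i + 1] for [x_i], hence the subtractions of 1. *)
Definition scan_arc : cmd :=
  Seq (NSet 3 [:: %10; %11] %17)
    (If (NLe (NGet 2 [:: %10; %11]) (NNum 0))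
      (TSet 2 [:: %10; %11] (TGet 0 [:: %10; %11]))
      (Seq (TSet 2 [:: %10; %11] TInf)
      (Seq (NSet 5 [:: NSub (NGet 2 [:: %10; %11]) (NNum 1)] %10)
      (Seq (NSet 6 [:: NSub (NGet 2 [:: %10; %11]) (NNum 1)] %11)
           (TSet 3 [:: NSub (NGet 2 [:: %10; %11]) (NNum 1)]
             (TGet 0 [:: %10; %11])))))).

Definition relax_via : cmd :=
  TSet 2 [:: %10; %11]
    (TMin (TGet 2 [:: %10; %11])
      (TAdd (TGet 2 [:: %10; %12]) (TGet 2 [:: %12; %11]))).

(** Capping the diagonal entry of the pivot by the real 0 accounts for the empty walk. *)
Definition floyd_warshall : cmd :=
  For 12 0
    (Seq (TSet 2 [:: %12; %12] (TMin (TGet 2 [:: %12; %12]) TZero))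
         (ForNodes relax_via)).

Definition init_term : cmd :=
  If (NLe %14 (NNum 0))
    (TSet 1 [:: %10; %11; %14] (TGet 2 [:: %10; %11]))
    (TSet 1 [:: %10; %11; %14] TInf).

Definition relax_arc : cmd :=
  Seq (NSet 4 [:: %10; %11; %14; %16] (NNum 1))
    (TSet 1 [:: %10; %11; %14]
      (TMin (TGet 1 [:: %10; %11; %14])
        (TAdd (TGet 2 [:: %10; NGet 5 [:: %16]])
          (TAdd (TGet 3 [:: %16])
            (TGet 1 [:: NGet 6 [:: %16]; %11; NSub %14 (NGet 7 [:: %16])]))))).

Definition skip_arc : cmd := NSet 4 [:: %10; %11; %14; %16] (NNum 0).

(** Sets are treated in increasing order, so [j - 2 ^ i] is finished before [j]. Digits are decoded
    from the top, once per set and not per pair, which leaves constant work in the innermost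
    loop. *)
Definition held_karp : cmd :=
  For 14 17
    (Seq (NSet 15 [::] %14)
    (Seq (ForNodes init_term)
         (For 13 1
           (Seq (NSet 16 [::] (NSub %1 (NAdd %13 (NNum 1))))
             (If (NLe (NGet 7 [:: %16]) %15)
               (Seq (NSet 15 [::] (NSub %15 (NGet 7 [:: %16])))
                    (ForNodes relax_arc))
               (ForNodes skip_arc)))))).

Definition kleene_star_program : cmd :=
  Seq init_lam (Seq powers (Seq (ForNodes scan_arc)
    (Seq floyd_warshall held_karp))).

Lemma runs_init_lam k st Q : nmem st 1 [::] = k ->
  (forall st1, agree_off [:: 13%N] [:: 3%N] st st1 ->
     (forall i, (i < k)%N -> tmem st1 3 [:: i] = 0) -> Q st1) ->
  runs init_lam (maxn 1 k * 19) st Q.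
Proof.
move=> st_k post.
apply: (@runs_for _ _ _ _ k 3 _ (fun m st1 =>
  forall i, (i < m)%N -> tmem st1 3 [:: i] = 0)) => //.
move=> m st1 lt_mk agr st1_m Inv; apply: (@runs_loopfree _ _ st1) => //= i.
by rewrite /upd /= st1_m eqseq_cons eqxx andbT ltnS leq_eqVlt; case: eqP => //= _ /Inv.
Qed.

Lemma runs_powers k st Q : nmem st 1 [::] = k ->
  (forall st1, agree_off [:: 7; 13; 17]%N [::] st st1 ->
     (forall i, (i <= k)%N -> nmem st1 7 [:: i] = 2 ^ i)%N ->
     nmem st1 17 [::] = (2 ^ k)%N -> Q st1) ->
  runs powers (3 + (maxn 1 k * 25 + 3)) st Q.
Proof.
move=> st_k post; apply: (@runs_seq _ _ _ 3); apply: runs_loopfree => //.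
apply: runs_seq; set st1 := effect _ _.
apply: (@runs_for _ _ _ _ k 9 _ (fun m st1 =>
  forall i, (i <= m)%N -> nmem st1 7 [:: i] = 2 ^ i)%N) => //.
- by case.
- move=> m st2 lt_mk agr st2_m Inv; apply: (@runs_loopfree _ _ st2) => //= i.
  rewrite /upd /= st2_m addn1 eqseq_cons eqxx andbT leq_eqVlt ltnS.
  case: eqP => [->|_] /= im.
    by rewrite Inv // addnn -mul2n -expnS.
  exact: Inv.
move=> st2 agr2 Inv; apply: (@runs_loopfree _ _ st2) => //=.
have st2_k : nmem st2 1 [::] = k by rewrite agr2.1.
apply: post.
- split=> [a|a _]; last by rewrite /= agr2.2.
  rewrite !inE !negb_or => /and3P[a7 a13 a17] /=.
  rewrite upd_off // agr2.1 ?inE ?negb_or ?a13 // /st1 /=.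
  by rewrite upd_off.
- by move=> i ik; rewrite /= /upd /= Inv.
by rewrite /= /upd /= st2_k Inv.
Qed.

(** * Correctness and cost of each phase *)

Section Correctness.
Variables (k n : nat) (D : 'M[tpoly R k]_n).
Variables (co : 'I_n -> 'I_n -> trop R) (va : 'I_n -> 'I_n -> option 'I_k).
Hypothesis D_lab : arc_labels D co va.

Definition stores_arc st (i : 'I_k) (x y : 'I_n) : Prop :=
  [/\ nmem st 5 [:: val i] = x, nmem st 6 [:: val i] = y
    & tmem st 3 [:: val i] = co x y].

Definition stores_arcs st : Prop :=
  (forall i x y, va x y = Some i -> stores_arc st i x y) /\
  (forall i : 'I_k, tmem st 3 [:: val i] = 0 \/ exists x y, va x y = Some i).

Definition dist st (u v : 'I_n) : trop R := tmem st 2 [:: val u; val v].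

Lemma runs_scan N st Q : nmem st 0 [::] = n -> nmem st 17 [::] = N ->
  (forall u v : 'I_n, nmem st 2 [:: val u; val v] =
     oapp (fun i : 'I_k => (val i).+1) 0%N (va u v)) ->
  (forall u v : 'I_n, tmem st 0 [:: val u; val v] = co u v) ->
  (forall i, (i < k)%N -> tmem st 3 [:: i] = 0) ->
  (forall st1, agree_off [:: 3; 5; 6; 10; 11]%N [:: 2; 3]%N st st1 ->
     (forall u v : 'I_n, nmem st1 3 [:: val u; val v] = N) ->
     (forall u v, dist st1 u v = if va u v is None then co u v else 0) ->
     stores_arcs st1 -> Q st1) ->
  runs (ForNodes scan_arc) (nodes_cost n scan_arc) st Q.
Proof.
move=> st_n st_N st_va st_co st_lam post.
apply: (@runs_for_nodes _ n _ _
  (fun st1 => forall i : 'I_k, tmem st1 3 [:: val i] = 0 \/ exists x y, va x y = Some i)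
  (fun u v st1 => [/\ nmem st1 3 [:: val u; val v] = N,
    dist st1 u v = if va u v is None then co u v else 0
    & forall i, va u v = Some i -> stores_arc st1 i u v])) => //.
- by move=> u v st1 a x; rewrite !inE => /orP[]/eqP ->; exact: id.
- by move=> i; left; rewrite st_lam ?ltn_ord.
- move=> u v st1 agr st1_u st1_v Inv1.
  have st1_N : nmem st1 17 [::] = N by rewrite agr.1.
  have := st_va u v; have := st_co u v.
  rewrite -agr.1 // -agr.2 // => st1_co st1_va.
  rewrite /scan_arc /dist /stores_arc /= /upd /=.
  rewrite /= st1_u st1_v st1_va st1_N {st1_va}.
  case def_i: (va u v) => [i|] /=; rewrite ?subn1 /= ?eqxx.
    split.
    - move=> i'; rewrite eqseq_cons eqxx andbT.
      case: eqP => [/val_inj ->|_]; last exact: Inv1.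
      by right; exists u, v.
    - by split=> // j [<-]; rewrite eqxx.
    move=> u' v' [size_uv dist_uv arc_uv]; split; first by case: ifP.
      by case: eqP => [[/val_inj -> /val_inj ->]|_]; rewrite ?def_i.
    move=> j def_j; have [e5 e6 e3] := arc_uv j def_j.
    rewrite !eqseq_cons !eqxx !andbT; case: eqP => [/val_inj eq_ji|_]; last by split.
    (* By separation of variables, only one arc ever writes to the slot of [i]. *)
    rewrite eq_ji in def_j.
    by have [-> ->] := proj2 D_lab _ _ _ _ _ def_j def_i.
  split; [exact: Inv1|by split|].
  move=> u' v' [size_uv dist_uv arc_uv]; split; [by case: ifP| |exact: arc_uv].
  by case: eqP => [[/val_inj -> /val_inj ->]|_]; rewrite ?def_i.
move=> st1 agr Inv1 Fact1; apply: post.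
- by apply: agree_off_sub agr; apply/allP.
- by move=> u v; case: (Fact1 u v).
- by move=> u v; case: (Fact1 u v).
by split=> // i x y def_i; case: (Fact1 x y) => _ _; apply.
Qed.

Lemma runs_floyd_warshall st Q : nmem st 0 [::] = n ->
  (forall u v, dist st u v = if va u v is None then co u v else 0) ->
  (forall st1, agree_off [:: 10; 11; 12]%N [:: 2]%N st st1 ->
     (forall u v, sum_of_walks D u v (tconst k (dist st1 u v))) ->
     bounds_inner co va n (dist st1) -> (forall u, tle (dist st1 u u) 1) ->
     Q st1) ->
  runs floyd_warshall
    (maxn 1 n * (8 + nodes_cost n relax_via + 16)) st Q.
Proof.
move=> st_n st_dist post.
apply: (@runs_for _ _ _ _ n _ _ (fun m st1 =>
  [/\ forall u v, sum_of_walks D u v (tconst k (dist st1 u v)),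
     bounds_inner co va m (dist st1)
   & forall u : 'I_n, (u < m)%N -> tle (dist st1 u u) 1])) => //.
- split=> // [u v|u v s uniq_s].
    rewrite /dist /= -/(dist st u v) st_dist.
    have := sum_of_walks_arc D u v; rewrite (proj1 D_lab).
    case: (va u v) => [i _|/=]; last by rewrite mulr1.
    by rewrite tconst0; apply: sum_of_walks0.
  case: s uniq_s => //= _ _; rewrite /dist /= -/(dist st u v) st_dist mulr1.
  by case: (va u v) => //= _; apply: tle_refl.
- move=> m st1 lt_mn agr st1_m [walks1 bounds1 diag1].
  pose w := Ordinal lt_mn.
  apply: runs_seq; apply: (@runs_loopfree _ _ st1) => //=.
  rewrite st1_m; set st2 := State _ _.
  have dist2 u v : dist st2 u v =
      if (u == w) && (v == w) then dist st1 w w + 1 else dist st1 u v.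
    by rewrite /dist /= /upd /= !eqseq_cons eqxx andbT.
  have dist21 u v : tle (dist st2 u v) (dist st1 u v).
    rewrite dist2; case: ifP => [/andP[/eqP -> /eqP ->]|_]; first exact: tle_addl.
    exact: tle_refl.
  (* A relaxation may read entries already lowered in this round. As entries only decrease,
     comparison with the start [st2] of the round suffices. *)
  apply: (@runs_for_nodes _ n _ _
    (fun st3 => (forall u v, sum_of_walks D u v (tconst k (dist st3 u v))) /\
       (forall u v, tle (dist st3 u v) (dist st2 u v)))
    (fun u v st3 => tle (dist st3 u v) (dist st2 u w * dist st2 w v))) => //.
  + by rewrite /= agr.1.
  + split=> u v; last exact: tle_refl.
    rewrite dist2; case: ifP => [/andP[/eqP -> /eqP ->]|_ //].
    by rewrite tconstD tconst1; apply: sum_of_walksD (sum_of_walks1 _ _).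
  + move=> u v st3 agr3 st3_u st3_v [walks3 le3].
    have st3_w : nmem st3 12 [::] = w by rewrite agr3.1.
    have dist4 u' v' : dist (effect relax_via st3) u' v' =
        if (u' == u) && (v' == v) then dist st3 u v + dist st3 u w * dist st3 w v
        else dist st3 u' v'.
      rewrite /dist /= /upd /= st3_u st3_v st3_w !eqseq_cons eqxx andbT.
      by case: ifP => // /andP[/eqP/val_inj -> /eqP/val_inj ->].
    have dist43 u' v' : tle (dist (effect relax_via st3) u' v') (dist st3 u' v').
      rewrite dist4; case: ifP => [/andP[/eqP -> /eqP ->]|_]; first exact: tle_addl.
      exact: tle_refl.
    split.
    * split=> u' v'; last by apply: tle_trans (dist43 u' v') (le3 u' v').
      rewrite dist4; case: ifP => [/andP[/eqP -> /eqP ->]|_ //].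
      by rewrite tconstD tconstM; apply: sum_of_walksD => //; apply: sum_of_walksM.
    * rewrite dist4 !eqxx /=; apply: tle_trans (tle_addr _ _) _.
      by apply: tle_mul; apply: le3.
    by move=> u' v'; apply: tle_trans; apply: dist43.
  move=> st3 agr3 [walks3 le3] via3; split=> //.
    apply: (@bounds_inner_step _ _ _ _ _ w (dist st1)) => // u v.
      exact: tle_trans (le3 u v) (dist21 u v).
    by apply: tle_trans (via3 u v) _; apply: tle_mul.
  move=> u; rewrite ltnS leq_eqVlt => /orP[/eqP um|/diag1].
    rewrite (_ : u = w); last exact: val_inj.
    by apply: tle_trans (le3 w w) _; rewrite dist2 eqxx tle_addr.
  by apply: tle_trans; apply: tle_trans (le3 u u) (dist21 u u).
move=> st1 agr [walks1 bounds1 diag1]; apply: post => // [|u].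
  by apply: agree_off_sub agr; apply/allP.
by apply: diag1.
Qed.

Definition term st (j : nat) (u v : 'I_n) : trop R :=
  tmem st 1 [:: val u; val v; j].

Definition exponent st (u v : 'I_n) j i : nat :=
  nmem st 4 [:: val u; val v; j; i].

Definition same_terms j st st' : Prop := forall j', j' != j ->
  (forall u v, term st' j' u v = term st j' u v) /\
  (forall u v i, exponent st' u v j' i = exponent st u v j' i).

(** Stated with raw cells, because the stored tail and head need not be nodes when [x_i] is on no
    arc. *)
Definition detour st j (i : nat) (u v : 'I_n) : trop R :=
  tmem st 2 [:: val u; nmem st 5 [:: i]] *
  (tmem st 3 [:: i] * tmem st 1 [:: nmem st 6 [:: i]; val v; (j - nmem st 7 [:: i])%N]).

(* The term j is correct as far as its indeterminates i >= m are concerned.   *)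
Definition relaxed m st j : Prop :=
  [/\ forall u v, sum_of_walks D u v (tconst k (term st j u v) * monomial R k j),
     j = 0%N -> forall u v, tle (term st j u v) (dist st u v),
     forall (i : 'I_k) x y u v, (m <= i)%N -> bit j i -> va x y = Some i ->
       tle (term st j u v) (dist st u x * (co x y * term st (j - 2 ^ i)%N y v))
   & forall u v i, (m <= i < k)%N -> exponent st u v j i = bit j i].

Lemma detour_arc st j (i : 'I_k) x y u v :
  nmem st 7 [:: val i] = (2 ^ i)%N -> stores_arc st i x y ->
  detour st j i u v = dist st u x * (co x y * term st (j - 2 ^ i)%N y v).
Proof. by move=> st_pow [e5 e6 e3]; rewrite /detour st_pow e5 e6 e3. Qed.

(** Either the coefficient of [x_i] is oo, or its arc is joined to a walk before it and a walk after
    it. *)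
Lemma detour_walks st j (i : 'I_k) u v :
  nmem st 7 [:: val i] = (2 ^ i)%N -> stores_arcs st -> bit j i ->
  (forall u v, sum_of_walks D u v (tconst k (dist st u v))) ->
  (forall u v, sum_of_walks D u v
     (tconst k (term st (j - 2 ^ i)%N u v) * monomial R k (j - 2 ^ i)%N)) ->
  sum_of_walks D u v (tconst k (detour st j i u v) * monomial R k j).
Proof.
move=> st_pow [arcs arcs0] ji dist_walks term_walks.
case: (arcs0 i) => [lam0|[x [y def_i]]].
  by rewrite /detour lam0 mul0r mulr0 tconst0 mul0r; apply: sum_of_walks0.
rewrite (detour_arc _ _ _ st_pow (arcs i x y def_i)) (monomial_sub _ ji).
rewrite !tconstM -!mulrA; apply: sum_of_walksM (dist_walks u x) _.
rewrite (mulrCA (tconst k (term _ _ _ _))) (mulrA (tconst k (co x y))).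
apply: sum_of_walksM (term_walks y v).
by have := sum_of_walks_arc D x y; rewrite (proj1 D_lab) def_i.
Qed.

Definition tables st : Prop :=
  [/\ nmem st 0 [::] = n, nmem st 1 [::] = k,
     forall i, (i <= k)%N -> nmem st 7 [:: i] = (2 ^ i)%N,
     stores_arcs st & forall u v, sum_of_walks D u v (tconst k (dist st u v))].

(** The side condition concerns concrete array names, so callers discharge it by computation, with
    [isT]. *)
Lemma tables_agree na ta st st' : agree_off na ta st st' ->
  ~~ has (mem na) [:: 0; 1; 5; 6; 7]%N && ~~ has (mem ta) [:: 2; 3]%N ->
  tables st -> tables st' /\ forall u v, dist st' u v = dist st u v.
Proof.
move=> [agr_n agr_t]; rewrite /= !orbF !negb_or.
case/andP=> /and5P[a0 a1 a5 a6 a7] /andP[b2 b3] [t0 t1 t7 [arcs arcs0] td].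
have e2 : tmem st' 2 = tmem st 2 by apply: agr_t.
have e3 : tmem st' 3 = tmem st 3 by apply: agr_t.
have e5 : nmem st' 5 = nmem st 5 by apply: agr_n.
have e6 : nmem st' 6 = nmem st 6 by apply: agr_n.
split; last by move=> u v; rewrite /dist e2.
split; rewrite ?agr_n //.
  split; last by move=> i; rewrite e3.
  by move=> i x y /arcs[]; rewrite /stores_arc e3 e5 e6.
by move=> u v; rewrite /dist e2.
Qed.

Lemma same_terms_trans j st1 st2 st3 :
  same_terms j st1 st2 -> same_terms j st2 st3 -> same_terms j st1 st3.
Proof.
move=> s12 s23 j' jj'; have [t12 e12] := s12 j' jj'; have [t23 e23] := s23 j' jj'.
by split=> *; rewrite ?t23 ?e23.
Qed.

Lemma relaxed_same m j j' st st' :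
  same_terms j st st' -> (forall u v, dist st' u v = dist st u v) ->
  (j' < j)%N -> relaxed m st j' -> relaxed m st' j'.
Proof.
move=> sam dists jj' [rel1 rel2 rel3 rel4].
have [t e] := sam j' (negbT (ltn_eqF jj')).
split=> [u v|j0 u v|i x y u v mi ji def_i|u v i ik].
- by rewrite t.
- by rewrite t dists; apply: rel2.
- rewrite t dists (sam (j' - 2 ^ i)%N _).1; first exact: rel3.
  by rewrite ltn_eqF // (leq_ltn_trans (leq_subr _ _)).
by rewrite e; apply: rel4.
Qed.

Lemma bit_sub_neq j i : bit j i -> (j - 2 ^ i)%N != j.
Proof.
move=> ji; have := bit_leq ji; have : (0 < 2 ^ i)%N by rewrite expn_gt0.
by lia.
Qed.

(** The term read, that of [j - 2 ^ i], is finished and not written to while [j] is processed, so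
    the order of the pairs does not matter. *)
Lemma runs_relax_arc st j (i : 'I_k) Q :
  tables st -> nmem st 14 [::] = j -> nmem st 16 [::] = i ->
  bit j i -> (j < 2 ^ k)%N ->
  (forall j', (j' < j)%N -> relaxed 0 st j') -> relaxed i.+1 st j ->
  (forall st1, agree_off [:: 4; 10; 11]%N [:: 1]%N st st1 ->
     same_terms j st st1 -> relaxed i st1 j -> Q st1) ->
  runs (ForNodes relax_arc) (nodes_cost n relax_arc) st Q.
Proof.
move=> tab st_j st_i ji j_lt done_lt [rel1 rel2 rel3 rel4] post.
have [st_n _ _ _ _] := tab.
have lt_j : (j - 2 ^ i < j)%N by rewrite ltn_neqAle bit_sub_neq ?leq_subr.
apply: (@runs_for_nodes _ n _ _
  (fun st1 => [/\ same_terms j st st1,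
     forall u v, sum_of_walks D u v (tconst k (term st1 j u v) * monomial R k j),
     forall u v, tle (term st1 j u v) (term st j u v)
   & forall u v (i' : nat), i' != i -> exponent st1 u v j i' = exponent st u v j i'])
  (fun u v st1 => exponent st1 u v j i = 1%N /\
     forall x y, va x y = Some i ->
       tle (term st1 j u v) (dist st u x * (co x y * term st (j - 2 ^ i)%N y v)))) => //.
- by move=> st1 a x; rewrite !inE => /orP[]/eqP ->; exact: id.
- by move=> u v st1 a x; rewrite !inE => /orP[]/eqP ->; exact: id.
- by split=> // u v; apply: tle_refl.
- move=> u v st1 agr st1_u st1_v [sam1 walks1 le1 exp1].
  have [tab1 dist1] := tables_agree agr isT tab.
  have st1_j : nmem st1 14 [::] = j by rewrite agr.1.
  have st1_i : nmem st1 16 [::] = i by rewrite agr.1.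
  have [_ _ pow1 arcs1 walks_dist1] := tab1.
  set st2 := effect _ _.
  have term2 j' u' v' : term st2 j' u' v' =
      if [&& u' == u, v' == v & j' == j] then term st1 j u v + detour st1 j i u v
      else term st1 j' u' v'.
    rewrite /term /st2 /= /upd /= st1_u st1_v st1_j st1_i !eqseq_cons eqxx andbT.
    by case: ifP => // /and3P[/eqP/val_inj -> /eqP/val_inj -> /eqP ->].
  have exp2 u' v' j' i' : exponent st2 u' v' j' i' =
      if [&& u' == u, v' == v, j' == j & i' == i :> nat] then 1%N
      else exponent st1 u' v' j' i'.
    by rewrite /exponent /st2 /= /upd /= st1_u st1_v st1_j st1_i !eqseq_cons eqxx andbT.
  have le21 u' v' : tle (term st2 j u' v') (term st1 j u' v').
    rewrite term2 eqxx andbT; case: ifP => [/andP[/eqP -> /eqP ->]|_].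
      exact: tle_addl.
    exact: tle_refl.
  split.
  + split=> [|u' v'|u' v'|u' v' i' ii'].
    * apply: same_terms_trans sam1 _ => j' jj'; split=> [u' v'|u' v' i'].
        by rewrite term2 (negbTE jj') !andbF.
      by rewrite exp2 (negbTE jj') !andbF.
    * rewrite term2; case: ifP => [/and3P[/eqP -> /eqP -> _]|_ //].
      rewrite tconstD mulrDl; apply: sum_of_walksD => //.
      apply: detour_walks => // [|u1 v1].
        by apply: pow1; apply: ltnW; apply: ltn_ord.
      rewrite (sam1 _ (bit_sub_neq ji)).1.
      by have [] := done_lt _ lt_j.
    * exact: tle_trans (le21 u' v') (le1 u' v').
    by rewrite exp2 (negbTE ii') !andbF exp1.
  + rewrite exp2 !eqxx; split=> // x y def_i; rewrite term2 !eqxx /=.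
    apply: tle_trans (tle_addr _ _) _; rewrite (detour_arc _ _ _ _ (arcs1.1 _ _ _ def_i)).
      by rewrite dist1 (sam1 _ (bit_sub_neq ji)).1 tle_refl.
    by apply: pow1; apply: ltnW; apply: ltn_ord.
  move=> u' v' [exp_uv le_uv]; split; first by rewrite exp2 exp_uv; case: ifP.
  by move=> x y /le_uv; apply: tle_trans.
move=> st1 agr [sam1 walks1 le1 exp1] fact1.
have [tab1 dist1] := tables_agree agr isT tab.
apply: post => //; first by apply: agree_off_sub agr; apply/allP.
split=> // [j0 u v|i' x y u v|u v i'].
- by rewrite dist1; apply: tle_trans (le1 u v) (rel2 j0 u v).
- rewrite leq_eqVlt => /orP[/eqP/val_inj <- _ def_i|lt_ii' ji' def_i'].
    by rewrite dist1 (sam1 _ (bit_sub_neq ji)).1; apply: (fact1 u v).2.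
  rewrite dist1 (sam1 _ (bit_sub_neq ji')).1.
  exact: tle_trans (le1 u v) (rel3 _ _ _ _ _ lt_ii' ji' def_i').
case/andP; rewrite leq_eqVlt => /orP[/eqP <- _|lt_ii' lt_i'k].
  by rewrite (fact1 u v).1 ji.
by rewrite exp1 ?rel4 ?lt_ii' // gtn_eqF.
Qed.

(** The exponent 0 has to be written explicitly, as output cells may hold anything initially. *)
Lemma runs_skip_arc st j (i : 'I_k) Q :
  tables st -> nmem st 14 [::] = j -> nmem st 16 [::] = i ->
  ~~ bit j i -> relaxed i.+1 st j ->
  (forall st1, agree_off [:: 4; 10; 11]%N [:: 1]%N st st1 ->
     same_terms j st st1 -> relaxed i st1 j -> Q st1) ->
  runs (ForNodes skip_arc) (nodes_cost n skip_arc) st Q.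
Proof.
move=> tab st_j st_i ji [rel1 rel2 rel3 rel4] post.
have [st_n _ _ _ _] := tab.
apply: (@runs_for_nodes _ n _ _
  (fun st1 => forall u v j' i', [|| j' != j | i' != i :> nat] ->
     exponent st1 u v j' i' = exponent st u v j' i')
  (fun u v st1 => exponent st1 u v j i = 0%N)) => //.
- by move=> st1 a x; rewrite !inE => /orP[]/eqP ->; exact: id.
- by move=> u v st1 a x; rewrite !inE => /orP[]/eqP ->; exact: id.
- move=> u v st1 agr st1_u st1_v exp1.
  have st1_j : nmem st1 14 [::] = j by rewrite agr.1.
  have st1_i : nmem st1 16 [::] = i by rewrite agr.1.
  set st2 := effect _ _.
  have exp2 u' v' j' i' : exponent st2 u' v' j' i' =
      if [&& u' == u, v' == v, j' == j & i' == i :> nat] then 0%N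
      else exponent st1 u' v' j' i'.
    by rewrite /exponent /st2 /= /upd /= st1_u st1_v st1_j st1_i !eqseq_cons eqxx andbT.
  split=> [u' v' j' i' ji'||u' v' exp_uv].
  + by rewrite exp2 -exp1 //; case: ifP ji' => // /and4P[_ _ -> ->].
  + by rewrite exp2 !eqxx.
  by rewrite exp2 exp_uv; case: ifP.
move=> st1 agr exp1 fact1.
have [tab1 dist1] := tables_agree agr isT tab.
have e1 : tmem st1 1 = tmem st 1 by apply: agr.2.
have term1 j' u v : term st1 j' u v = term st j' u v by rewrite /term e1.
apply: post; first by apply: agree_off_sub agr; apply/allP.
  by move=> j' jj'; split=> // u v i'; apply: exp1; rewrite jj'.
split=> [u v|j0 u v|i' x y u v|u v i'].
- by rewrite term1.
- by rewrite dist1 term1; apply: rel2.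
- rewrite leq_eqVlt => /orP[/eqP/val_inj <-|lt_ii' ji' def_i'].
    by rewrite (negbTE ji).
  by rewrite dist1 !term1; apply: rel3.
case/andP; rewrite leq_eqVlt => /orP[/eqP <- _|lt_ii' lt_i'k].
  by rewrite fact1 (negbTE ji).
rewrite exp1; first by rewrite rel4 // lt_ii'.
by rewrite (gtn_eqF lt_ii') orbT.
Qed.

(** At level [k] the clauses of [relaxed] about indeterminates are void; what remains is the seed,
    the constant distances for the empty set and oo otherwise. *)
Lemma runs_init_term st j Q :
  tables st -> nmem st 14 [::] = j ->
  (forall st1, agree_off [:: 10; 11]%N [:: 1]%N st st1 ->
     same_terms j st st1 -> relaxed k st1 j -> Q st1) ->
  runs (ForNodes init_term) (nodes_cost n init_term) st Q.
Proof.
move=> tab st_j post; have [st_n _ _ _ _] := tab.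
apply: (@runs_for_nodes _ n _ _ (same_terms j st)
  (fun u v st1 => term st1 j u v = if j == 0%N then dist st u v else 0)) => //.
- by move=> st1 a x; rewrite !inE => /orP[]/eqP ->; exact: id.
- move=> u v st1 agr st1_u st1_v sam1.
  have st1_j : nmem st1 14 [::] = j by rewrite agr.1.
  have [_ dist1] := tables_agree agr isT tab.
  set st2 := effect _ _.
  have term2 j' u' v' : term st2 j' u' v' =
      if [&& u' == u, v' == v & j' == j] then if j == 0%N then dist st u v else 0
      else term st1 j' u' v'.
    rewrite /term /st2 /= st1_j leqn0 -dist1.
    by case: ifP => _; rewrite /= /upd /= st1_u st1_v ?st1_j !eqseq_cons eqxx andbT.
  split=> [|//|u' v' term_uv]; last first.
  + by rewrite term2 term_uv; case: ifP => // /and3P[/eqP -> /eqP -> _].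
  + by rewrite term2 !eqxx.
  apply: same_terms_trans sam1 _ => j' jj'; split=> [u' v'|u' v' i'].
    by rewrite term2 (negbTE jj') !andbF.
  by rewrite /exponent /st2 /=; case: ifP.
move=> st1 agr sam1 fact1.
have [[_ _ _ _ walks1] dist1] := tables_agree agr isT tab.
apply: post => //; first by apply: agree_off_sub agr; apply/allP.
split=> [u v|j0 u v|i x y u v ki|u v i]; last by rewrite ltnNge andbN.
- rewrite fact1; case: eqP => [->|_].
    by rewrite monomial0 mulr1 -dist1.
  by rewrite tconst0 mul0r; apply: sum_of_walks0.
- by rewrite fact1 j0 dist1 tle_refl.
by have := ltn_ord i; rewrite ltnNge ki.
Qed.

(** The 15 is 6 for the index, 4 for the test and 5 for the new residue. *)
Definition arc_cost : nat := (15 + nodes_cost n relax_arc)%N.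

Lemma runs_arc st j m Q :
  tables st -> nmem st 13 [::] = m -> nmem st 14 [::] = j ->
  nmem st 15 [::] = (j %% 2 ^ (k - m))%N -> (m < k)%N -> (j < 2 ^ k)%N ->
  (forall j', (j' < j)%N -> relaxed 0 st j') -> relaxed (k - m) st j ->
  (forall st1, same_terms j st st1 ->
     nmem st1 15 [::] = (j %% 2 ^ (k - m.+1))%N ->
     relaxed (k - m.+1) st1 j -> Q st1) ->
  runs (Seq (NSet 16 [::] (NSub %1 (NAdd %13 (NNum 1))))
         (If (NLe (NGet 7 [:: %16]) %15)
           (Seq (NSet 15 [::] (NSub %15 (NGet 7 [:: %16])))
                (ForNodes relax_arc))
           (ForNodes skip_arc))) arc_cost st Q.
Proof.
move=> tab st_m st_j st_rest lt_mk lt_j done_j rel post.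
have [_ st_k pow _ _] := tab.
have lt_i : (k - m.+1 < k)%N by rewrite ltn_subrL (leq_ltn_trans _ lt_mk).
pose i := Ordinal lt_i.
have def_i : (k - m = i.+1)%N by rewrite /= subnSK.
rewrite -[(k - m.+1)%N]/(val i) in post; rewrite def_i in st_rest rel.
rewrite /arc_cost -[15%N]/(6 + (4 + 5))%N -!addnA; apply: runs_seq.
apply: runs_loopfree => //=; rewrite st_k st_m addn1.
set st1 := State _ _; apply: (@runs_if _ _ _ _ (5 + nodes_cost n relax_arc)%N).
have st1_i : nmem st1 16 [::] = i by rewrite /= /upd.
have bit_test : beval st1 (NLe (NGet 7 [:: %16]) %15) = bit j i.
  by rewrite /= /upd /= st_rest pow ?bit_modn // ltnW.
rewrite bit_test; case: ifP => ji; last first.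
  apply: (@runs_weaken _ _ (nodes_cost n skip_arc) _ _ Q) => //.
    apply: leq_trans (leq_addl _ _); rewrite /nodes_cost.
    by rewrite leq_mul // leq_add2r leq_mul.
  apply: (@runs_skip_arc st1 j i) => //; first by rewrite ji.
  move=> st2 agr sam rel2; apply: post => //.
  by rewrite agr.1 // /st1 /= /upd /= st_rest modn_bit ji mul0n.
apply: (@runs_seq _ _ _ 5); apply: runs_loopfree => //.
apply: (@runs_relax_arc _ j i) => //.
move=> st3 agr sam rel3; apply: post => //.
rewrite agr.1 //= /upd /= st_rest pow; last by rewrite ltnW.
by rewrite modn_bit ji mul1n addKn.
Qed.

Definition set_cost : nat :=
  (2 + (nodes_cost n init_term + maxn 1 k * (arc_cost + 16)))%N.

Lemma runs_held_karp st Q :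
  tables st -> nmem st 17 [::] = (2 ^ k)%N ->
  (forall st1, agree_off [:: 4; 10; 11; 13; 14; 15; 16]%N [:: 1]%N st st1 ->
     (forall j, (j < 2 ^ k)%N -> relaxed 0 st1 j) -> Q st1) ->
  runs held_karp (2 ^ k * (set_cost + 16)) st Q.
Proof.
move=> tab st_N post.
have -> : (2 ^ k = maxn 1 (2 ^ k))%N by apply/esym/maxn_idPr; rewrite expn_gt0.
apply: (@runs_for _ _ _ _ (2 ^ k)%N _ _
  (fun m st1 => forall j, (j < m)%N -> relaxed 0 st1 j)) => //; last first.
  by move=> st1 agr; apply: post; apply: agree_off_sub agr; apply/allP.
move=> j st1 lt_j agr st1_j done_j.
have [tab1 _] := tables_agree agr isT tab.
have [_ st1_k _ _ _] := tab1.
apply: runs_seq; apply: runs_loopfree => //=; rewrite st1_j; set st2 := State _ _.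
apply: runs_seq; apply: (@runs_init_term st2 j) => // st3 agr3 sam3 rel3.
have [tab3 dist3] := tables_agree agr3 isT (tab1 : tables st2).
have done3 j' : (j' < j)%N -> relaxed 0 st3 j'.
  by move=> jj'; apply: relaxed_same sam3 dist3 jj' (done_j j' jj').
apply: (@runs_for _ _ _ _ k _ _ (fun m st4 =>
  [/\ same_terms j st3 st4, relaxed (k - m) st4 j
    & nmem st4 15 [::] = (j %% 2 ^ (k - m))%N])) => //.
- by rewrite agr3.1.
- split=> //; first by rewrite subn0.
  by rewrite /= /upd /= agr3.1 // subn0 modn_small.
- move=> m st4 lt_m agr4 st4_m [sam4 rel4 st4_rest].
  have [tab4 dist4] := tables_agree agr4 isT tab3.
  apply: (@runs_arc st4 j m) => //.
  + by rewrite agr4.1 // agr3.1.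
  + by move=> j' jj'; apply: relaxed_same sam4 dist4 jj' (done3 j' jj').
  by move=> st5 sam5 rest5 rel5; split=> //; apply: same_terms_trans sam4 sam5.
move=> st4 agr4 [sam4 rel4 _]; rewrite subnn in rel4 => j'.
have [tab4 dist4] := tables_agree agr4 isT tab3.
rewrite ltnS leq_eqVlt => /orP[/eqP -> //|jj'].
by apply: relaxed_same sam4 dist4 jj' (done3 j' jj').
Qed.

End Correctness.
End Program.

(** * The whole program and its running time *)

Section Result.
Variables (R : realType) (k n : nat) (D : 'M[tpoly R k]_n).

(** The program needs the labels found in memory, rather than those that [separated_arc_labels]
    obtains by choice. *)
Lemma input_arc_labels (st : state R) :
  separated_variables D -> input_state D st ->
  exists va : 'I_n -> 'I_n -> option 'I_k,
    arc_labels D (fun u v => tmem st 0 [:: val u; val v]) va /\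
    forall u v : 'I_n, nmem st 2 [:: val u; val v] =
      oapp (fun i : 'I_k => (val i).+1) 0%N (va u v).
Proof.
move=> [_ D_inj] [_ _ st_arcs].
pose va u v : option 'I_k :=
  if nmem st 2 [:: val (u : 'I_n); val (v : 'I_n)] is i.+1 then insub i else None.
have va_spec u v : D u v = tconst k (tmem st 0 [:: val u; val v]) *
      oapp (@tvar R k) 1 (va u v) /\
    nmem st 2 [:: val u; val v] = oapp (fun i : 'I_k => (val i).+1) 0%N (va u v) /\
    (forall i, va u v = Some i -> occurs i (D u v)).
  rewrite /va; have := st_arcs u v; case: (nmem st 2 _) => [|i] /=.
    by rewrite mulr1.
  move=> [j [l [<- st_l Duv]]]; rewrite valK /= st_l; split=> //; split=> //.
  by move=> _ [<-]; exists l.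
exists va; split; last by move=> u v; case: (va_spec u v) => _ [].
split=> [u v|i u v u' v' def_i def_i']; first by case: (va_spec u v).
have [_ [_ occ]] := va_spec u v; have [_ [_ occ']] := va_spec u' v'.
exact: D_inj (occ i def_i) (occ' i def_i').
Qed.

Definition program_cost : nat :=
  maxn 1 k * 19 + ((3 + (maxn 1 k * 25 + 3)) +
    (nodes_cost n scan_arc +
      (maxn 1 n * (8 + nodes_cost n relax_via + 16) +
        2 ^ k * (set_cost k n + 16)))).

Lemma runs_kleene_star_program (st : state R) :
  separated_variables D -> input_state D st ->
  runs kleene_star_program program_cost st
    (fun st' => represents_kleene_star D (output_matrix k n st')).
Proof.
move=> D_sep st_in; have [va [D_lab st_va]] := input_arc_labels D_sep st_in.
have [st_n st_k _] := st_in; set co := fun u v => _ in D_lab.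
apply: runs_seq; apply: (runs_init_lam st_k) => st1 agr1 lam1.
apply: runs_seq; apply: runs_powers; first by rewrite agr1.1.
move=> st2 agr2 pow2 N2.
have agr12 : agree_off [:: 7; 13; 17]%N [:: 3%N] st st2.
  apply: agree_off_trans (agree_off_sub _ _ agr1) (agree_off_sub _ _ agr2);
  exact/allP.
apply: runs_seq; apply: (runs_scan D_lab (N := (2 ^ k)%N)) => //.
- by rewrite agr12.1.
- by move=> u v; rewrite agr12.1.
- by move=> u v; rewrite agr12.2.
- by move=> i ik; rewrite agr2.2 // lam1.
move=> st3 agr3 size3 dist3 arcs3.
apply: runs_seq; apply: (runs_floyd_warshall D_lab) => //.
  by rewrite agr3.1 // agr12.1.
move=> st4 agr4 walks4 bounds4 diag4.
have tab4 : tables D co va st4.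
  split=> //.
  - by rewrite agr4.1 // agr3.1 // agr12.1.
  - by rewrite agr4.1 // agr3.1 // agr12.1.
  - by move=> i ik; rewrite agr4.1 // agr3.1 // pow2.
  have [arcs arcs0] := arcs3; split=> [i x y /arcs[e5 e6 e3]|i]; last by rewrite agr4.2.
  by split; [rewrite agr4.1|rewrite agr4.1|rewrite agr4.2].
apply: (runs_held_karp D_lab tab4); first by rewrite agr4.1 // agr3.1.
move=> st5 agr5 rel5; have [_ dist5] := tables_agree agr5 isT tab4.
have size5 (u v : 'I_n) : nmem st5 3 [:: val u; val v] = (2 ^ k)%N.
  by rewrite agr5.1 // agr4.1.
have -> : output_matrix k n st5 =
    \matrix_(u, v) \sum_(j < 2 ^ k) tconst k (term st5 j u v) * monomial R k j.
  apply/matrixP => u v; rewrite !mxE size5; apply: eq_bigr => j _; congr (_ * _).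
  apply: eq_bigr => i _; congr (_ ^+ _).
  by have [_ _ _] := rel5 j (ltn_ord j); apply; rewrite ltn_ord.
apply: (representsI D_lab) => [j u v lt_j|].
  by have [] := rel5 j lt_j.
apply: (path_bound D_lab bounds4 diag4) => [u v|j i x y u v lt_j ji def_i].
  have [|_ rel _ _] := rel5 0%N; first by rewrite expn_gt0.
  by rewrite -dist5; apply: rel.
by have [_ _ rel _] := rel5 j lt_j; rewrite -dist5; apply: rel.
Qed.

End Result.

Lemma nodes_cost_le n c : (0 < n)%N ->
  (nodes_cost n c <= (max_cost c + 32) * n ^ 2)%N.
Proof.
move=> n_gt0; rewrite /nodes_cost (maxn_idPr n_gt0) -mulnn; move: (max_cost c); nia.
Qed.

Definition cost_factor : nat := 19 + 31 + (max_cost scan_arc + 32) +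
  (24 + max_cost relax_via + 32) +
  (18 + (max_cost init_term + 32) + 31 + (max_cost relax_arc + 32)).

(** The factor [maxn 1 k] replaces [k] because the cubic work of Floyd-Warshall remains when
    [k = 0]. *)
Lemma program_cost_le k n : (0 < n)%N ->
  (program_cost k n <= cost_factor * (maxn 1 k * 2 ^ k * n ^ 3))%N.
Proof.
move=> n_gt0; rewrite /program_cost /set_cost /arc_cost /cost_factor.
move: (nodes_cost_le scan_arc n_gt0) (nodes_cost_le relax_via n_gt0).
move: (nodes_cost_le init_term n_gt0) (nodes_cost_le relax_arc n_gt0).
move: (nodes_cost n scan_arc) (nodes_cost n relax_via) => A B.
move: (nodes_cost n init_term) (nodes_cost n relax_arc) => C E.
move: (max_cost scan_arc) (max_cost relax_via) => a b.
move: (max_cost init_term) (max_cost relax_arc) => c e.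
have S_gt0 : (0 < n ^ 2)%N by rewrite expn_gt0 n_gt0.
have K_gt0 : (0 < maxn 1 k)%N by rewrite leq_max.
have P_gt0 : (0 < 2 ^ k)%N by rewrite expn_gt0.
rewrite (maxn_idPr n_gt0) [(n ^ 3)%N]expnS.
move: (n ^ 2)%N (maxn 1 k) (2 ^ k)%N S_gt0 K_gt0 P_gt0.
move=> S K P S_gt0 K_gt0 P_gt0 leC leE leA leB; set X := (K * P * (n * S))%N.
(* All factors are positive, so each product in the cost is at most [X]. *)
have le_nS : (n * S <= X)%N by rewrite leq_pmull ?muln_gt0 ?K_gt0.
have le_S : (S <= X)%N by apply: leq_trans le_nS; rewrite leq_pmull.
have le_n : (n <= X)%N by apply: leq_trans le_nS; rewrite leq_pmulr.
have le_KP : (K * P <= X)%N by rewrite leq_pmulr ?muln_gt0 ?n_gt0.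
have le_K : (K <= X)%N by apply: leq_trans le_KP; rewrite leq_pmulr.
have le_P : (P <= X)%N by apply: leq_trans le_KP; rewrite leq_pmull.
have le_KPS : (K * P * S <= X)%N by rewrite leq_mul2l leq_pmull ?orbT.
have le_PS : (P * S <= X)%N.
  by apply: leq_trans le_KPS; rewrite -mulnA leq_pmull.
have X_gt0 : (0 < X)%N by apply: leq_trans K_gt0 le_K.
have leA' : (A <= (a + 32) * X)%N by apply: leq_trans leA _; rewrite leq_mul2l le_S orbT.
have leB' : (n * B <= (b + 32) * X)%N.
  apply: leq_trans (leq_mul (leqnn n) leB) _.
  by rewrite mulnCA leq_mul2l le_nS orbT.
have leC' : (P * C <= (c + 32) * X)%N.
  apply: leq_trans (leq_mul (leqnn P) leC) _.
  by rewrite mulnCA leq_mul2l le_PS orbT.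
have leE' : (K * P * E <= (e + 32) * X)%N.
  apply: leq_trans (leq_mul (leqnn (K * P)%N) leE) _.
  by rewrite mulnCA leq_mul2l le_KPS orbT.
have -> : (K * 19 + (3 + (K * 25 + 3) + (A + (n * (8 + B + 16) +
    P * (2 + (C + K * (15 + E + 16)) + 16)))) =
  K * 44 + 6 + A + n * 24 + n * B + P * 18 + P * C + K * P * 31 + K * P * E)%N.
  by lia.
move: X le_nS le_S le_n le_KP le_K le_P le_KPS le_PS X_gt0 leA' leB' leC' leE'.
move=> X le_nS le_S le_n le_KP le_K le_P le_KPS le_PS X_gt0 leA' leB' leC' leE'.
(* With the products turned into atoms, the inequality is linear. *)
move: (n * B)%N (P * C)%N (K * P * E)%N (K * P)%N leA' leB' leC' leE' le_KP.
by move=> nB PC KPE KP; rewrite !mulnDl; lia.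
Qed.

Theorem theorem4 (R : realType) :
  (forall (k n : nat) (D : 'M[tpoly R k]_n),
     separated_variables D ->
     forall (u v : 'I_n) (ps : seq (seq 'I_n)),
       uniq ps ->
       (forall p, p \in ps -> shortest_path D u v p) ->
       (forall p q, p \in ps -> q \in ps -> p <> q ->
          incomparable (weight D u p) (weight D u q)) ->
       (size ps <= 2 ^ k)%N)
  /\
  (exists (c : cmd) (C : nat),
     forall (k n : nat) (D : 'M[tpoly R k]_n),
       (0 < n)%N ->
       separated_variables D ->
       ~ negative_cycle D ->
       forall st : state R, input_state D st ->
       exists (st' : state R) (t : nat),
         [/\ exec c st st' t,
             (t <= C * (maxn 1 k * 2 ^ k * n ^ 3))%N
           & represents_kleene_star D (output_matrix k n st')]).
Proof.
split=> [k n D D_sep u v ps ps_uniq ps_short ps_inc|].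
  have [co [va D_lab]] := separated_arc_labels D_sep.
  apply: (@incomparable_paths_bound _ _ _ _ _ _ D_lab u v ps) => // p p_in.
  by have [] := ps_short p p_in.
exists kleene_star_program, cost_factor => k n D n_gt0 D_sep _ st st_in.
apply: runs_weaken (runs_kleene_star_program D_sep st_in) => //.
exact: program_cost_le.
Qed.
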